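(* Consider the mirror descent stochastic approximation (MDSA) iteration described in the context for $\min_{\mathbf p\in\mathcal U}Z(\mathbf p)$, where $\hat\psi$ is one of the gradient estimators SFE, FFE, CFE, with expectation $\psi=E[\hat\psi]$, and with a set of parameters such that, for some constants $B_1,B_2$ and all small enough perturbation sizes $c>0$, $$\|\psi(\mathbf p)-\nabla Z(\mathbf p)-\epsilon_0(\mathbf p)\mathbf 1\|\le B_1c\quad\text{for some }\epsilon_0(\mathbf p)\in\mathbb R\text{ depending on }\mathbf p,\qquad E[\|\hat\psi-\psi\|^2]\le B_2\frac{\gamma}{Rc^2}.$$ Choose the step size $\rho_k=a/k^\alpha$ with $a>0$ and $\frac12<\alpha\le1$, the perturbation size $c_k=b/k^\theta$ with $b>0$ and $\alpha+\theta>1$, the number of simulation replications $R_k=[R_0k^\beta]+1$ with $R_0>0$ and $2\alpha+\beta-2d-2\theta>1$ (where $d$ is the exponent in (A6)), and $\gamma_k=\gamma_0\big(\min_{i\in[m]}\min_{j\in[n^i]}p^i_{k,j}\big)^{-2}$ with $\gamma_0>0$. Then, under assumptions (A1), (A2), (A5) and (A6), $\mathbf p_k$ converges to $\mathbf p^*$ almost surely.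
   Context: Setting. $[N]=\{1,\dots,N\}$. For $i\in[m]$, $\mathcal P^{n^i}$ is the probability simplex in $\mathbb R^{n^i}$; $Z:\prod_{i=1}^m\mathcal P^{n^i}\to\mathbb R$; $\mathbf p=vec(\mathbf p^1,\dots,\mathbf p^m)$ is the concatenation of $\mathbf p^i=(p^i_1,\dots,p^i_{n^i})\in\mathcal P^{n^i}$. $\mathcal U=\prod_{i=1}^m\mathcal U^i$ with each $\mathcal U^i\subseteq\mathcal P^{n^i}$ nonempty, compact and convex. $\|\cdot\|$ is the Euclidean norm (spectral norm for matrices), $\mathbf 1$ the all-ones vector, $[x]$ the integer part of $x$. Derivatives. $F:\prod_i\mathcal P^{n^i}\to\mathbb R$ is differentiable at $\mathbf p$ if $F(\mathbf q)-F(\mathbf p)=\nabla F(\mathbf p)'(\mathbf q-\mathbf p)+o(\|\mathbf q-\mathbf p\|)$ for $\mathbf q\in\prod_i\mathcal P^{n^i}$, where $\nabla F(\mathbf p)=vec(\nabla_{\mathbf p^i}F(\mathbf p):i\in[m])$ is the version whose $(i,j)$ component is the limit, as $\epsilon\to0_+$, of $\epsilon^{-1}$ times the increment of $F$ when $\mathbf p^i$ is replaced by $(1-\epsilon)\mathbf p^i+\epsilon\mathbf e_j$ (other blocks fixed). Second derivatives and $\nabla^2F$ are defined recursively in the same way. Assumptions. (A1) $Z$ is $\mathcal C^2$ (derivatives up to order 2 exist and are continuous), and $Z,\nabla Z,\nabla^2Z$ are Lipschitz with constants $L_0,L_1,L_2$. (A2) Noisy evaluations satisfy $E[\hat Z(\mathbf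 p)]=Z(\mathbf p)$, $\mathrm{Var}[\hat Z(\mathbf p)]\le\sigma^2$ with $\sigma^2>0$ constant. (A5) The problem $\min_{\mathbf q\in\mathcal U}Z(\mathbf q)$ has a unique optimal solution $\mathbf p^*\in\mathcal U$, and $\nabla Z(\mathbf q)'(\mathbf q-\mathbf p^* )>0$ for every $\mathbf q\in\mathcal U$, $\mathbf q\ne\mathbf p^*$. (A6) The MDSA iterates satisfy $\min_{l\in[m],j\in[n^l]}p^l_{k,j}\ge\bar A/k^d$ for all $k$, for some constants $\bar A,d>0$. Gradient estimators at $\mathbf p$, with perturbation size $c$, $R$ replications and multiplier $\gamma>0$. With $\boldsymbol\delta^1,\dots,\boldsymbol\delta^R$ i.i.d. random elements of $\prod_i\mathcal P^{n^i}$ and independent evaluations $\hat Z^j$, and $S(\mathbf p,\boldsymbol\delta)=\gamma(\boldsymbol\delta-\mathbf p)$: SFE is $\frac1R\sum_j\frac{\hat Z^j((1-c)\mathbf p+c\boldsymbol\delta^j)}{c}S(\mathbf p,\boldsymbol\delta^j)$; FFE is $\frac1R\sum_j\frac{\hat Z^{2j-1}((1-c)\mathbf p+c\boldsymbol\delta^j)-\hat Z^{2j}(\mathbf p)}{c}S(\mathbf p,\boldsymbol\delta^j)$; CFE is $\frac1R\sum_j\frac{\hat Z^{2j-1}((1-c)\mathbf p+c\boldsymbol\delta^j)-\hat Z^{2j}((1+c)\mathbf p-c\boldsymbol\delta^j)}{2c}S(\mathbf p,\boldsymbol\delta^j)$. All evaluation points are assumed to lie in $\prod_i\mathcal P^{n^i}$.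 The bias and variance bounds in the claim are understood to hold with constants $B_1,B_2$ uniform over $\mathbf p\in\mathcal U$ with strictly positive entries, with $\gamma=\gamma_0(\min_{i,j}p^i_j)^{-2}$. MDSA. For probability vectors, $V(\mathbf x,\mathbf z)=\sum_iz_i\log(z_i/x_i)$ (with $0\log0=0$), the Bregman distance of the entropy $w(\mathbf x)=\sum_ix_i\log x_i$; for concatenated vectors, $V(\mathbf p,\mathbf q)=\sum_{l=1}^mV(\mathbf p^l,\mathbf q^l)$. Start with $\mathbf p_1\in\mathcal U$. At iteration $k$, given $\mathbf p_k$ (with entries $p^i_{k,j}$), compute $\hat\psi(\mathbf p_k)$ using $c_k,R_k,\gamma_k$ and randomness which, given $\mathbf p_k$, is independent of the past, and set $\mathbf p_{k+1}=\arg\min_{\mathbf q\in\mathcal U}\{\rho_k\hat\psi(\mathbf p_k)'(\mathbf q-\mathbf p_k)+V(\mathbf p_k,\mathbf q)\}$. *)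

(* Defs.v *)
From HB Require Import structures.
From mathcomp Require Import all_boot all_order all_algebra.
From mathcomp Require Import all_classical all_reals all_analysis measurable_realfun.
Import Order.TTheory GRing.Theory Num.Theory.
Import numFieldNormedType.Exports.

Set Implicit Arguments.
Unset Strict Implicit.
Unset Printing Implicit Defensive.

Local Open Scope classical_set_scope.
Local Open Scope ring_scope.

Section RowVectors.
Context {R : realType} {N : nat}.

Definition dot (u v : 'rV[R]_N) : R := \sum_k u 0 k * v 0 k.

(* The library norm on matrices is the sup norm; it is used only through the
   topology it induces. *)
Definition enorm (u : 'rV[R]_N) : R := Num.sqrt (\sum_k u 0 k ^+ 2).

(* x *m A^T is the row form of the column A x. *)
Definition spectral_norm (A : 'M[R]_N) : R :=
  sup [set enorm (x *m A^T) | x in [set x : 'rV[R]_N | enorm x <= 1]].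

Definition simplex : set 'rV[R]_N :=
  [set x | (forall j, 0 <= x 0 j) /\ \sum_j x 0 j = 1].

(* \sum_i z_i log (z_i / x_i); the conventions ln 0 = 0 and 0 * _ = 0 give
   0 log 0 = 0. Meaningful when all the entries of x are positive. *)
Definition KL (x z : 'rV[R]_N) : R := \sum_j z 0 j * ln (z 0 j / x 0 j).

Definition is_argmin (S : set 'rV[R]_N) (f : 'rV[R]_N -> R) (x : 'rV[R]_N) :=
  S x /\ forall y, S y -> f x <= f y.

End RowVectors.

Arguments simplex {R} N.

(* R^N with its Borel sigma-algebra *)
Definition borelV (R : realType) (N : nat) := g_sigma_algebraType (@open 'rV[R]_N).

(* vec(p^1, ..., p^m) is a row vector of length \sum_i n i, its block p^i is
   [submxrow p i]. *)
Section Blocks.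
Context {R : realType} {m : nat} {n : 'I_m -> nat}.
Local Notation vec := 'rV[R]_(\sum_(i < m) n i).

Definition block_prod (S : forall i : 'I_m, set 'rV[R]_(n i)) : set vec :=
  [set p | forall i : 'I_m, S i (submxrow p i)].

Definition prod_simplex : set vec := block_prod (fun i => simplex (n i)).

(* The neutral value 1 is harmless: entries of probability vectors are <= 1. *)
Definition min_entry (p : vec) : R :=
  \big[Num.min/1]_(i < m) \big[Num.min/1]_(j < n i) submxrow p i 0 j.

Definition blockKL (p q : vec) : R :=
  \sum_(l < m) KL (submxrow p l) (submxrow q l).

(* p with its block p^i replaced by (1 - eps) p^i + eps e_j *)
Definition perturb (p : vec) (i : 'I_m) (j : 'I_(n i)) (eps : R) : vec :=
  \mxrow_(l < m) dfwith (submxrow p) i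
    ((1 - eps) *: submxrow p i + eps *: delta_mx 0 j : 'rV[R]_(n i)) l.

Definition diff_quot (F : vec -> R) (p : vec) (i : 'I_m) (j : 'I_(n i))
    (eps : R) : R :=
  eps^-1 * (F (perturb p j eps) - F p).

Definition grad (F : vec -> R) (p : vec) : vec :=
  \mxrow_(i < m) \row_(j < n i) lim (diff_quot F p j @ 0^'+).

(* Differentiability at p relative to the product of simplices; only the values
   of F there matter. *)
Definition simplex_differentiable (F : vec -> R) (p : vec) : Prop :=
  (forall (i : 'I_m) (j : 'I_(n i)), cvg (diff_quot F p j @ 0^'+)) /\
  (forall e : R, 0 < e ->
     \forall q \near within prod_simplex (nbhs p),
       `|F q - F p - dot (grad F p) (q - p)| <= e * enorm (q - p)).

Definition hess (F : vec -> R) (p : vec) : 'M[R]_(\sum_(i < m) n i) :=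
  \matrix_(k, l) grad (fun q => grad F q 0 k) p 0 l.

Definition simplex_C2 (F : vec -> R) : Prop :=
  [/\ forall p, prod_simplex p -> simplex_differentiable F p,
      forall k p, prod_simplex p ->
        simplex_differentiable (fun q => grad F q 0 k) p,
      {within prod_simplex, continuous F},
      {within prod_simplex, continuous (grad F)} &
      {within prod_simplex, continuous (hess F)}].

Definition smooth_lipschitz (F : vec -> R) (L0 L1 L2 : R) : Prop :=
  simplex_C2 F /\
  forall p q, prod_simplex p -> prod_simplex q ->
    [/\ `|F p - F q| <= L0 * enorm (p - q),
        enorm (grad F p - grad F q) <= L1 * enorm (p - q) &
        spectral_norm (hess F p - hess F q) <= L2 * enorm (p - q)].

Definition unique_strict_optimum (F : vec -> R) (U : set vec) (pstar : vec) :=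
  [/\ is_argmin U F pstar,
      forall q, is_argmin U F q -> q = pstar &
      forall q, U q -> q != pstar -> 0 < dot (grad F q) (q - pstar)].

Definition positive_part (U : set vec) : set vec :=
  [set p | U p /\ forall k, 0 < p 0 k].

End Blocks.

Inductive estimator := SFE | FFE | CFE.

(* A noisy evaluation of the objective at q is [Zhat q x], where x is the seed
   of the evaluation; independent evaluations use independent seeds. Only feasible q matter. *)
Section Estimators.
Context {R : realType} {m : nat} {n : 'I_m -> nat} {Xi : Type}.
Local Notation vec := 'rV[R]_(\sum_(i < m) n i).
Variable Zhat : vec -> Xi -> R.

Definition forward (c : R) (p dl : vec) : vec := (1 - c) *: p + c *: dl.
Definition backward (c : R) (p dl : vec) : vec := (1 + c) *: p - c *: dl.

(* The evaluation at p itself in FFE is not listed, as p is feasible. *)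
Definition valid_points (est : estimator) (c : R) (p dl : vec) : Prop :=
  match est with
  | SFE | FFE => prod_simplex (forward c p dl)
  | CFE => prod_simplex (forward c p dl) /\ prod_simplex (backward c p dl)
  end.

(* Replication j = 0, 1, ... uses seed j for SFE, and seeds 2j, 2j+1 for FFE
   and CFE. *)
Definition slope (est : estimator) (c : R) (p dl : vec) (x : nat -> Xi)
    (j : nat) : R :=
  match est with
  | SFE => Zhat (forward c p dl) (x j) / c
  | FFE => (Zhat (forward c p dl) (x j.*2) - Zhat p (x j.*2.+1)) / c
  | CFE => (Zhat (forward c p dl) (x j.*2)
            - Zhat (backward c p dl) (x j.*2.+1)) / (2 * c)
  end.

Definition score (gamma : R) (p dl : vec) : vec := gamma *: (dl - p).

Definition grad_estimate (est : estimator) (p : vec) (c : R) (reps : nat)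
    (gamma : R) (dl : nat -> vec) (x : nat -> Xi) : vec :=
  reps%:R^-1 *: \sum_(j < reps) slope est c p (dl j) x j *: score gamma p (dl j).

End Estimators.

(* All the randomness consumed by one estimation is a point of W: directions
   [delta j w] and evaluation seeds [zeta j w], j = 0, 1, ... When estimating
   at p it has law Q p, so that the law of the directions may depend on p. *)
Section Sampling.
Context {R : realType} {m : nat} {n : 'I_m -> nat}.
Context {dW dX : measure_display} {W : measurableType dW}
        {Xi : measurableType dX}.
Local Notation vec := 'rV[R]_(\sum_(i < m) n i).
Local Notation bvec := (borelV R (\sum_(i < m) n i)).
Variables (nu : probability Xi R) (Zhat : vec -> Xi -> R).
Variables (Q : vec -> probability W R).
Variables (delta : nat -> W -> vec) (zeta : nat -> W -> Xi).

Definition unbiased_evaluations (Z : vec -> R) (sigma : R) : Prop :=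
  measurable_fun [set: (bvec * Xi)%type]
    (fun x : bvec * Xi => Zhat x.1 x.2) /\
  forall q, prod_simplex q ->
    ('E_nu[Zhat q] = (Z q)%:E /\ 'V_nu[Zhat q] <= (sigma ^+ 2)%:E)%E.

(* The product rule says at once that, under Q p, all the directions and seeds
   are mutually independent, the directions have a common law and the seeds
   have law nu. *)
Definition sampling_model (D : set vec) : Prop :=
  [/\ forall B : set W, measurable B ->
        measurable_fun [set: bvec] (fun p : bvec => Q p B),
      forall j, measurable_fun [set: W] (delta j : W -> bvec),
      forall j, measurable_fun [set: W] (zeta j),
      forall j w, prod_simplex (delta j w) &
      forall p, D p -> forall (r : nat) (B : nat -> set bvec) (C : nat -> set Xi),
        (forall j, measurable (B j)) -> (forall j, measurable (C j)) ->
        Q p ((\bigcap_(j in `I_r) (delta j @^-1` B j)) `&`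
             (\bigcap_(j in `I_r) (zeta j @^-1` C j))) =
        ((\prod_(j < r) Q p (delta 0%N @^-1` B j)) *
         (\prod_(j < r) nu (C j)))%E].

Definition psihat (est : estimator) (p : vec) (c : R) (reps : nat) (gamma : R)
    (w : W) : vec :=
  grad_estimate Zhat est p c reps gamma (delta ^~ w) (zeta ^~ w).

Definition psi (est : estimator) (p : vec) (c : R) (reps : nat) (gamma : R) :
    vec :=
  \row_k fine ('E_(Q p)[fun w => (psihat est p c reps gamma w 0 k)%R])%E.

(* gamma = gamma0 (min_{i,j} p^i_j)^{-2} *)
Definition multiplier (gamma0 : R) (p : vec) : R := gamma0 * min_entry p ^- 2.

(* Bias and variance bounds, uniform over p in D and over 0 < c < c0, for the
   pairs (p, c) whose evaluation points are feasible. *)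
Definition bias_variance_bounds (est : estimator) (Z : vec -> R) (D : set vec)
    (gamma0 B1 B2 c0 : R) : Prop :=
  forall (p : vec) (c : R) (reps : nat),
    D p -> 0 < c < c0 -> (0 < reps)%N ->
    {ae Q p, forall w, forall j, valid_points est c p (delta j w)} ->
    let gamma := multiplier gamma0 p in
    let mean := psi est p c reps gamma in
    (exists eps0 : R, enorm (mean - grad Z p - const_mx eps0) <= B1 * c) /\
    ('E_(Q p)[fun w => (enorm (psihat est p c reps gamma w - mean) ^+ 2)%R]
       <= (B2 * (gamma / (reps%:R * c ^+ 2)))%:E)%E.

End Sampling.

(* a / k^s, used for k >= 1 *)
Definition power_decay {R : realType} (a s : R) (k : nat) : R :=
  a / (k%:R `^ s).

(* [R0 k^beta] + 1 *)
Definition replications {R : realType} (R0 beta : R) (k : nat) : nat :=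
  (Num.truncn (R0 * (k%:R `^ beta))).+1.

(* Iterates and per-iteration randomness are indexed from 1. *)
Section Iteration.
Context {R : realType} {m : nat} {n : 'I_m -> nat}.
Context {dO dW : measure_display} {Omega : measurableType dO}
        {W : measurableType dW}.
Local Notation vec := 'rV[R]_(\sum_(i < m) n i).
Local Notation bvec := (borelV R (\sum_(i < m) n i)).
Variables (P : probability Omega R) (Q : vec -> probability W R).
Variables (p : nat -> Omega -> vec) (w : nat -> Omega -> W).

(* sigma-algebra generated by p_1, ..., p_k and the randomness of the
   iterations 1, ..., k - 1 *)
Definition past (k : nat) : set (set Omega) :=
  <<s [set A | exists l : nat, (0 < l <= k)%N /\
         exists2 B : set bvec, measurable B & A = p l @^-1` B] `|`
      [set A | exists l : nat, (0 < l < k)%N /\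
         exists2 B : set W, measurable B & A = w l @^-1` B] >>.

(* Given the past, the randomness of iteration k has law Q p_k: it is
   independent of the past given p_k. *)
Definition fresh_randomness : Prop :=
  forall k : nat, (0 < k)%N ->
  forall (A : set Omega) (B : set W), past k A -> measurable B ->
    P (A `&` w k @^-1` B) = (\int[P]_(o in A) Q (p k o) B)%E.

(* x' is the mirror descent update of x with step size rho and gradient
   estimate g *)
Definition mirror_step (U : set vec) (rho : R) (g x x' : vec) : Prop :=
  is_argmin U (fun q => rho * dot g (q - x) + blockKL x q) x'.

End Iteration.

(* Main.v *)
Require Import Defs.
From HB Require Import structures.
From mathcomp Require Import all_boot all_order all_algebra.
From mathcomp Require Import all_classical all_reals all_analysis measurable_realfun.
Import Order.TTheory GRing.Theory Num.Theory.
Import numFieldNormedType.Exports.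
From mathcomp Require Import ring lra.

Set Implicit Arguments.
Unset Strict Implicit.
Unset Printing Implicit Defensive.
Local Open Scope classical_set_scope.
Local Open Scope ring_scope.

(* Let V_k = V(p_k, p^* ). First-order optimality of the mirror step and
   V(x, z) >= |z - x|^2 / 4 give, with g the gradient estimate,
     V_{k+1} <= V_k + rho g.(p^* - p_k) + rho^2 |g|^2.
   Averaging over the randomness of step k, the bias and variance bounds yield
     E[V_{k+1}; A] <= E[V_k; A] - rho_k E[phi(p_k); A] + e_k P(A)
   for every event A of the past, where phi(q) = grad Z(q).(q - p^* ) and
   sum_k e_k < oo. The estimates are multiples of delta - p, whose entries sum
   to 0, so the mean of g is orthogonal to the all-ones vector and is bounded
   although eps_0(p) is not controlled.
   By compactness phi is bounded below away from p^*, so sum_k rho_k = oo makes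
   P(V_k > eps) arbitrarily small for some arbitrarily late k. From such a k on, an
   optional-stopping argument bounds the probability that V ever exceeds lam,
   on {V_k < eps}, by (eps + sum_{j >= k} e_j) / lam. Hence V_k -> 0 almost
   surely, and V dominates the squared distance. Only integrals of nonnegative
   functions appear, so no conditional expectation is needed. *)

(** * Joint law of a random point and a kernel *)

(** The increment rho g.(p^* - p_k) + rho^2 |g|^2 is signed. Adding N, the number of entries, makes
    it nonnegative: by completing the square, each entry contributes a square plus 1 - ((p^*_j -
    p_j)/2)^2. The term N P(A) then occurs on both sides of the averaged inequality, is finite, and
    cancels. The error e_k has three parts, one for each condition on the exponents: the bias rho_k
    c_k, of order k^-(alpha + theta); the squared mean of the estimate, of order k^-(2 alpha); and
    its variance, of order k^-(2 alpha + beta - 2 d - 2 theta). The entropy estimates are made entry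
    by entry on the concatenated vector, the linear terms cancelling because all points have the
    same total. The factor 1/4 is just what absorbs the cross term between g and the move p_{k+1} -
    p_k. The optimum may have zero entries, and [KL] takes default values when its first argument
    has one. That argument is kept positive by (A6), and V is truncated at 0 elsewhere. Feasibility
    of the evaluation points is known along the trajectory, whereas the moment bounds ask for it
    under the law Q p of all directions; the conditional law transfers it. *)

Section Kernels.
Context {d1 d2 : measure_display} {T1 : measurableType d1}
  {T2 : measurableType d2} {R : realType}.
Local Open Scope ereal_scope.

(** A measure is a kernel from the one-point space, so that composition of kernels can build a joint
    law from it. *)
Definition cst_kernel (mu : {finite_measure set T1 -> \bar R})
  (u : unit) : {measure set T1 -> \bar R} := mu.

Section cst_kernel.
Variable mu : {finite_measure set T1 -> \bar R}.

Let measurable_cst_kernel U : measurable U ->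
  measurable_fun [set: unit] (cst_kernel mu ^~ U).
Proof. by move=> mU; exact: measurable_cst. Qed.

HB.instance Definition _ := isKernel.Build _ _ _ _ _ (cst_kernel mu)
  measurable_cst_kernel.

Let cst_kernel_uub : measure_fam_uub (cst_kernel mu).
Proof.
exists (fine (mu setT) + 1)%R => u.
have muT : mu setT \is a fin_num by exact: fin_num_measure.
by rewrite /cst_kernel -[ltLHS]fineK// lte_fin ltrDl.
Qed.

HB.instance Definition _ := Kernel_isFinite.Build _ _ _ _ _ (cst_kernel mu)
  cst_kernel_uub.

End cst_kernel.

Definition snd_kernel (Q : T1 -> probability T2 R)
    (mQ : forall B, measurable B -> measurable_fun setT (Q ^~ B))
  (x : unit * T1) : {measure set T2 -> \bar R} := Q x.2.

Section snd_kernel.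
Variables (Q : T1 -> probability T2 R)
  (mQ : forall B, measurable B -> measurable_fun setT (Q ^~ B)).

Let measurable_snd_kernel U : measurable U ->
  measurable_fun [set: unit * T1] (snd_kernel mQ ^~ U).
Proof.
by move=> mU; apply: (measurableT_comp (mQ mU)); exact: measurable_snd.
Qed.

HB.instance Definition _ := isKernel.Build _ _ _ _ _ (snd_kernel mQ)
  measurable_snd_kernel.

Let snd_kernel_prob x : snd_kernel mQ x [set: T2] = 1.
Proof. exact: probability_setT. Qed.

HB.instance Definition _ := Kernel_isProbability.Build _ _ _ _ _
  (snd_kernel mQ) snd_kernel_prob.

End snd_kernel.

Lemma measurable_forget :
  measurable_fun [set: (unit * T1) * T2] (fun x : (unit * T1) * T2 => (x.1.2, x.2)).
Proof.
apply/measurable_fun_pairP; split => /=; last exact: measurable_snd.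
by apply: (measurableT_comp (f := snd)) => //; exact: measurable_fst.
Qed.

(** Law of (x, y) when x is drawn from [mu] and then y from [Q x]: the outer composition integrates
    over x, the inner one over y, and the Dirac kernel outputs the pair without its [unit]
    component. *)
Definition joint_measure (mu : {finite_measure set T1 -> \bar R})
    (Q : T1 -> probability T2 R)
    (mQ : forall B, measurable B -> measurable_fun setT (Q ^~ B)) :=
  (mkcomp (cst_kernel mu)
    (mkcomp (snd_kernel mQ) (kdirac measurable_forget))) tt.

End Kernels.
Section JointMeasure.
Context {d1 d2 : measure_display} {T1 : measurableType d1}
  {T2 : measurableType d2} {R : realType}.
Local Open Scope ereal_scope.
Variables (mu : {finite_measure set T1 -> \bar R})
    (Q : T1 -> probability T2 R)
    (mQ : forall B, measurable B -> measurable_fun setT (Q ^~ B)).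

Lemma ge0_integral_joint_measure (f : T1 * T2 -> \bar R) :
  (forall x, 0 <= f x) -> measurable_fun setT f ->
  \int[joint_measure mu mQ]_x f x = \int[mu]_x \int[Q x]_y f (x, y).
Proof.
move=> f0 mf; rewrite /joint_measure integral_kcomp//.
apply: eq_integral => x _.
rewrite integral_kcomp//.
apply: eq_integral => y _.
by rewrite integral_dirac//= diracT mul1e.
Qed.

Lemma joint_measure_setX (B1 : set T1) (B2 : set T2) :
  measurable B1 -> measurable B2 ->
  joint_measure mu mQ (B1 `*` B2) = \int[mu]_(x in B1) Q x B2.
Proof.
move=> mB1 mB2.
have mB : measurable (B1 `*` B2) by exact: measurableX.
rewrite -[LHS]mul1e -(@integral_cst _ _ _ (joint_measure mu mQ) _ mB 1).
rewrite -[in LHS](setTI (B1 `*` B2)) integral_mkcondr.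
rewrite ge0_integral_joint_measure; last 2 first.
- by move=> x; rewrite erestrict_ge0.
- by apply/(measurable_restrictT _ _).1.
rewrite [RHS]integral_mkcond; apply: eq_integral => x _.
rewrite patchE; case: ifPn => xB1.
- rewrite -[RHS]mul1e -integral_cst// [RHS]integral_mkcond.
  apply: eq_integral => y _; rewrite !patchE /=.
  congr (if _ then _ else _); apply/idP/idP; rewrite !inE//=.
    by case.
  by move: xB1; rewrite inE.
- apply: integral0_eq => y _; rewrite patchE; case: ifPn => //.
  by rewrite inE/= => -[xB1']; rewrite mem_set in xB1.
Qed.

(** Rectangles generate the product sigma-algebra, are stable under intersection and include the
    whole space, of finite mass. The freshness of the randomness is stated on rectangles, and this
    extends it to all events. *)
Lemma joint_measure_unique (nu : {measure set (T1 * T2) -> \bar R}) :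
  (forall B1 B2, measurable B1 -> measurable B2 ->
     nu (B1 `*` B2) = \int[mu]_(x in B1) Q x B2) ->
  forall B, measurable B -> nu B = joint_measure mu mQ B.
Proof.
move=> nuE B mB.
apply: (measure_unique [set A `*` B | A in measurable & B in measurable]
  (fun=> setT)) => //.
- by rewrite measurable_prod_measurableType.
- move=> _ _ [A1 mA1 [A2 mA2 <-]] [C1 mC1 [C2 mC2 <-]].
  exists (A1 `&` C1); first exact: measurableI.
  by exists (A2 `&` C2); [exact: measurableI|rewrite setXI].
- by move=> _; exists setT => //; exists setT => //; rewrite setXTT.
- by rewrite bigcup_const//; exists 0%N.
- by move=> _ [A1 mA1 [A2 mA2 <-]]; rewrite nuE// joint_measure_setX.
- move=> _; rewrite -setXTT nuE//.
  under eq_integral do rewrite probability_setT.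
  rewrite integral_cst// mul1e.
  exact: fin_num_fun_lty (fin_num_measure mu).
Qed.

End JointMeasure.

Section Restriction.
Context {d d1 : measure_display} {T : measurableType d}
  {T1 : measurableType d1} {R : realType}.
Local Open Scope ereal_scope.

(** [mu] is the sum of its restrictions to [A] and to the complement. The second one charges only
    points where [f \_ A] vanishes, and the first one does not see the complement. *)
Lemma ge0_integral_mrestr (mu : {measure set T -> \bar R}) (A : set T)
    (mA : measurable A) (f : T -> \bar R) :
  (forall x, 0 <= f x) -> measurable_fun setT f ->
  \int[mrestr mu mA]_x f x = \int[mu]_(x in A) f x.
Proof.
move=> f0 mf.
have mcA : measurable (~` A) by exact: measurableC.
pose m1 : {measure set T -> \bar R} := mrestr mu mA.
pose m2 : {measure set T -> \bar R} := mrestr mu mcA.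
have mfA : measurable_fun setT (f \_ A).
  by apply/(measurable_restrictT _ _).1 => //; exact: measurable_funTS.
have fA0 x : 0 <= (f \_ A) x by rewrite patchE; case: ifPn.
rewrite [RHS]integral_mkcond.
rewrite (eq_measure_integral (measure_add m1 m2)); last first.
  move=> B mB _; transitivity (m1 B + m2 B); last by rewrite -measure_addE.
  rewrite /m1 /m2 /= /mrestr -measureU//.
  - by rewrite -setIUr setUv setIT.
  - exact: measurableI.
  - exact: measurableI.
  - by rewrite setIACA setICr setI0.
rewrite ge0_integral_measure_add//.
rewrite [X in _ = _ + X](_ : _ = 0) ?adde0; last first.
  rewrite (ge0_negligible_integral mA measurableT) ?setTD//.
    by apply: integral0_eq => x Ax; rewrite patchE memNset.
  by rewrite /m2 /= /mrestr setICr measure0.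
rewrite (ge0_negligible_integral mcA measurableT)//; last first.
  by rewrite /m1 /= /mrestr setICl measure0.
rewrite [RHS](ge0_negligible_integral mcA measurableT)//; last first.
  by rewrite /m1 /= /mrestr setICl measure0.
apply: eq_integral => x; rewrite setTD setCK => xA.
by rewrite patchE xA.
Qed.

(** Law of [X] on the event [A], left unnormalised: conditioning on [A] then involves no division by
    its probability. *)
Definition restricted_law (mu : {measure set T -> \bar R}) (A : set T)
  (X : T -> T1) (mA : measurable A) (mX : measurable_fun setT X) :
  set T1 -> \bar R := fun B => mu (A `&` X @^-1` B).

Section restricted_law.
Variables (P : {finite_measure set T -> \bar R}) (A : set T) (X : T -> T1)
  (mA : measurable A) (mX : measurable_fun setT X).

Let mAX B : measurable B -> measurable (A `&` X @^-1` B).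
Proof.
by move=> mB; apply: measurableI => //; rewrite -[X in measurable X]setTI; exact: mX.
Qed.

Let law0 : restricted_law P mA mX set0 = 0.
Proof. by rewrite /restricted_law preimage_set0 setI0 measure0. Qed.

Let law_ge0 B : 0 <= restricted_law P mA mX B.
Proof. exact: measure_ge0. Qed.

Let law_sigma_additive : semi_sigma_additive (restricted_law P mA mX).
Proof.
move=> F mF tF mUF; rewrite /restricted_law preimage_bigcup setI_bigcupr.
apply: measure_semi_sigma_additive.
- by move=> n; exact: mAX.
- apply/trivIsetP => /= i j _ _ ij; rewrite setIACA -preimage_setI.
  by move/trivIsetP : tF => /(_ _ _ _ _ ij) ->//; rewrite preimage_set0 setI0.
- by rewrite -setI_bigcupr -preimage_bigcup; exact: mAX.
Qed.

HB.instance Definition _ := isMeasure.Build _ _ _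
  (restricted_law P mA mX) law0 law_ge0 law_sigma_additive.

Let law_fin : fin_num_fun (restricted_law P mA mX).
Proof. by move=> B mB; apply: fin_num_measure; exact: mAX. Qed.

HB.instance Definition _ := @Measure_isFinite.Build _ _ _
  (restricted_law P mA mX) law_fin.

Lemma ge0_integral_restricted_law (f : T1 -> \bar R) (B : set T1) :
  measurable B -> measurable_fun setT f -> (forall y, 0 <= f y) ->
  \int[restricted_law P mA mX]_(y in B) f y = \int[P]_(x in A `&` X @^-1` B) f (X x).
Proof.
move=> mB mf f0.
have mXB : measurable (X @^-1` B) by rewrite -[Y in measurable Y]setTI; exact: mX.
have mfX : measurable_fun setT (f \o X) by exact: measurableT_comp.
rewrite (eq_measure_integral (pushforward (mrestr P mA) X)); last first.
  by move=> C mC _; rewrite /= /pushforward /mrestr /restricted_law setIC.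
rewrite ge0_integral_pushforward//; last exact: measurable_funTS.
rewrite integral_mkcond ge0_integral_mrestr; last 2 first.
- by move=> x; rewrite erestrict_ge0//=.
- by apply/(measurable_restrictT _ _).1 => //; exact: measurable_funTS.
by rewrite -integral_mkcondr.
Qed.

End restricted_law.
End Restriction.

Section ConditionalLaw.
Context {d d1 d2 : measure_display} {T : measurableType d}
  {T1 : measurableType d1} {T2 : measurableType d2} {R : realType}.
Local Open Scope ereal_scope.
Variables (P : {finite_measure set T -> \bar R}) (Q : T1 -> probability T2 R)
  (mQ : forall B, measurable B -> measurable_fun setT (Q ^~ B)).

Lemma measurable_kernel_integral (f : T1 * T2 -> \bar R) :
  (forall x, 0 <= f x) -> measurable_fun setT f ->
  measurable_fun setT (fun x => \int[Q x]_y f (x, y)).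
Proof.
move=> f0 mf; pose g (x : (unit * T1) * T2) := f (x.1.2, x.2).
have mg : measurable_fun setT g by exact: measurableT_comp measurable_forget.
have := @measurable_fun_integral_finite_kernel _ _ _ _ _ g (snd_kernel mQ)
  (fun x => f0 _) mg.
by move=> /(fun h => measurableT_comp h (measurable_pair1 tt)).
Qed.

(** By the identity on rectangles, the law of (X, Y) on [A] is the joint law built from the law of
    [X] on [A] and the kernel [Q]; both sides integrate [f] against it. *)
Lemma ge0_integral_conditional (A : set T) (X : T -> T1) (Y : T -> T2)
    (f : T1 * T2 -> \bar R) :
  measurable A -> measurable_fun setT X -> measurable_fun setT Y ->
  (forall B1 B2, measurable B1 -> measurable B2 ->
     P ((A `&` X @^-1` B1) `&` Y @^-1` B2) =
     \int[P]_(o in A `&` X @^-1` B1) Q (X o) B2) ->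
  (forall x, 0 <= f x) -> measurable_fun setT f ->
  \int[P]_(o in A) f (X o, Y o) = \int[P]_(o in A) \int[Q (X o)]_y f (X o, y).
Proof.
move=> mA mX mY PE f0 mf.
have mXY : measurable_fun setT (fun o => (X o, Y o)) by exact: measurable_fun_pair.
have mI := measurable_kernel_integral f0 mf.
transitivity (\int[joint_measure (restricted_law P mA mX) mQ]_x f x); last first.
  rewrite ge0_integral_joint_measure// ge0_integral_restricted_law ?setIT//.
  by move=> x; exact: integral_ge0.
transitivity (\int[restricted_law P mA mXY]_x f x).
  by rewrite ge0_integral_restricted_law ?setIT.
apply: eq_measure_integral => B mB _.
apply: joint_measure_unique => // B1 B2 mB1 mB2.
rewrite ge0_integral_restricted_law//; last exact: mQ.
by rewrite -PE// /= /restricted_law -setIA.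
Qed.

(** Averaging the indicator of the complement of [S] gives 0, so the inner integral, which is a
    probability under [Q (X o)], vanishes for almost every o. *)
Lemma ae_conditional (X : T -> T1) (Y : T -> T2) (S : set (T1 * T2)) :
  measurable_fun setT X -> measurable_fun setT Y ->
  (forall B1 B2, measurable B1 -> measurable B2 ->
     P ((X @^-1` B1) `&` Y @^-1` B2) = \int[P]_(o in X @^-1` B1) Q (X o) B2) ->
  measurable S ->
  {ae P, forall o, S (X o, Y o)} ->
  {ae P, forall o, {ae Q (X o), forall y, S (X o, y)}}.
Proof.
move=> mX mY PE mS aeS.
have mXY : measurable_fun setT (fun o => (X o, Y o)) by exact: measurable_fun_pair.
pose f (x : T1 * T2) : \bar R := (\1_(~` S) x)%:E.
have f0 x : 0 <= f x by rewrite lee_fin.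
have mcS : measurable (~` S) by exact: measurableC.
have mf : measurable_fun setT f by exact/measurable_EFinP.
have int0 : \int[P]_o \int[Q (X o)]_y f (X o, y) = 0.
  rewrite -(ge0_integral_conditional measurableT mX mY _ f0 mf); last first.
    by move=> B1 B2 mB1 mB2; rewrite setTI PE.
  rewrite (ge0_ae_eq_integral (g := cst 0)) ?integral0//.
    exact: measurableT_comp mf mXY.
  by apply: filterS aeS => o So _; rewrite /f indicE memNset//=; exact.
have mI : measurable_fun setT (fun o => \int[Q (X o)]_y f (X o, y)).
  exact: (measurableT_comp (measurable_kernel_integral f0 mf) mX).
have : ae_eq P setT (fun o => \int[Q (X o)]_y f (X o, y)) (cst 0).
  apply/ae_eq_integral_abs => //.
  under eq_integral => o _ do rewrite gee0_abs ?integral_ge0//.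
  exact: int0.
apply: filterS => o /(_ Logic.I) /= I0.
have mSo : measurable [set y | ~ S (X o, y)].
  by have := measurable_pair1 (X o) measurableT mcS; rewrite setTI.
apply/negligibleP => //; rewrite -[RHS]I0 /f -[LHS]/(Q (X o) [set y | ~ S (X o, y)]).
rewrite -[X in _ _ X = _](setIT [set y | ~ S (X o, y)]) -integral_indic//.
Qed.

End ConditionalLaw.

(** * Almost supermartingales with a drift *)

Section Descent.
Context {d : measure_display} {T : measurableType d} {R : realType}.
Variables (P : probability T R) (F : nat -> set (set T)) (V : nat -> T -> R)
  (rho e : nat -> R) (K : nat).
Hypotheses (F_measurable : forall k A, F k A -> measurable A)
  (F_nondecreasing : forall k, F k `<=` F k.+1)
  (F_setI : forall k, setI_closed (F k))
  (F_setT : forall k, F k setT)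
  (F_lt : forall k r, F k [set o | V k o < r])
  (F_ge : forall k r, F k [set o | r <= V k o]).
Hypotheses (V_ge0 : forall k o, 0 <= V k o)
  (V_integrable : forall k, (K <= k)%N -> (\int[P]_o (V k o)%:E < +oo)%E)
  (rho_ge0 : forall k, 0 <= rho k) (e_ge0 : forall k, 0 <= e k)
  (rho_dvg : ~ cvgn (series rho)) (e_cvg : cvgn (series e)).
Hypothesis descent : forall eps : R, 0 < eps -> exists2 eta : R, 0 < eta &
  forall k A, (K <= k)%N -> F k A ->
  (\int[P]_(o in A) (V k.+1 o)%:E
     + (rho k * eta)%:E * P (A `&` [set o | eps <= V k o]%R)
   <= \int[P]_(o in A) (V k o)%:E + (e k)%:E * P A)%E.

Let V_measurable k : measurable_fun [set: T] (V k).
Proof.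
apply: (measurability _ (RGenCInfty.measurableE R)) => _ /= [_ [r ->] <-].
apply: measurableI => //.
rewrite (_ : _ @^-1` _ = [set o | r <= V k o]); first exact: F_measurable (F_ge k r).
by apply/seteqP; split => o /=; rewrite in_itv/= andbT.
Qed.

Let EV_measurable k A : measurable_fun A (fun o => (V k o)%:E).
Proof. by apply: measurable_funTS; exact/measurable_EFinP. Qed.

Definition exceeds (lam : R) (k n : nat) : set T :=
  \bigcup_(j in [set j | (k <= j <= k + n)%N]) [set o | lam <= V j o].

Let exceeds_measurable lam k n : measurable (exceeds lam k n).
Proof. by apply: bigcup_measurable => j _; exact: F_measurable (F_ge j lam). Qed.

Local Open Scope ereal_scope.

(** Induction on the horizon, for all events of the past at once. The part of [A] where V k >= lam
    is handled by Markov's inequality; the other part is an event of the past at k + 1, to which one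
    descent step and the induction hypothesis apply. This plays the role of stopping at the first
    passage above [lam]. *)
Lemma maximal_inequality lam n k A : (0 < lam)%R -> (K <= k)%N -> F k A ->
  lam%:E * P (A `&` exceeds lam k n) <=
  \int[P]_(o in A) (V k o)%:E + (\sum_(k <= i < k + n) e i)%:E * P A.
Proof.
move=> lam0; elim: n k A => [|n IH] k A Kk FA; have mA := F_measurable FA.
- rewrite addn0 big_geq// mul0e adde0.
  have -> : exceeds lam k 0 = [set o | lam <= V k o]%R.
    apply/seteqP; split => [ o [j]|o lo]; last by exists k => //=; rewrite addn0 leqnn.
    by rewrite /= addn0 andbC -eqn_leq => /eqP ->.
  have mB : measurable (A `&` [set o | lam <= V k o]%R).
    by apply: measurableI => //; exact: F_measurable (F_ge k lam).
  rewrite -integral_cst//.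
  apply: (@le_trans _ _ (\int[P]_(o in A `&` [set o | lam <= V k o]%R) (V k o)%:E)).
    by apply: ge0_le_integral => //= [x _|x [_ lx]]; rewrite lee_fin// ltW.
  by apply: ge0_subset_integral => //= o _; rewrite lee_fin.
- set A1 := A `&` [set o | lam <= V k o]%R.
  set A2 := A `&` [set o | V k o < lam]%R.
  have FA2 : F k A2 by exact: F_setI.
  have mA1 : measurable A1 by apply: F_measurable; apply: F_setI; [exact: FA|exact: F_ge].
  have mA2 : measurable A2 by exact: F_measurable FA2.
  have A12 : A = A1 `|` A2.
    rewrite /A1 /A2 -setIUr; apply/esym/setIidPl => o _.
    by rewrite /=; case: (leP lam (V k o)); [left|right].
  have sub : A `&` exceeds lam k n.+1 `<=` A1 `|` (A2 `&` exceeds lam k.+1 n).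
    move=> o [Ao [j /= /andP[kj jn] lj]].
    have [lo|lo] := leP lam (V k o); first by left.
    right; split => //; exists j => //=; rewrite addSnnS jn andbT.
    rewrite ltn_neqAle kj andbT; apply: contraTneq lo => ->.
    by rewrite -leNgt.
  have mE2 : measurable (A2 `&` exceeds lam k.+1 n) by exact: measurableI.
  apply: (@le_trans _ _ (lam%:E * (P A1 + P (A2 `&` exceeds lam k.+1 n)))).
    rewrite lee_pmul2l ?lte_fin//.
    apply: (@le_trans _ _ (P (A1 `|` (A2 `&` exceeds lam k.+1 n)))).
      by apply: le_measure => //; rewrite inE; [exact: measurableI|exact: measurableU].
    exact: measureU2.
  rewrite ge0_muleDr//.
  have IH2 := IH k.+1 A2 (leqW Kk) (F_nondecreasing FA2).
  (* Taking [lam] itself as the distance threshold empties the drift event on [A2], which leaves the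
     plain almost supermartingale inequality. *)
  have [eta eta0 /(_ k A2 Kk FA2)] := descent lam0.
  have -> : A2 `&` [set o | lam <= V k o]%R = set0.
    by apply/seteqP; split => // o [[_ /=]]; case: leP.
  rewrite measure0 mule0 adde0 => D2.
  have IA : \int[P]_(o in A) (V k o)%:E =
      \int[P]_(o in A1) (V k o)%:E + \int[P]_(o in A2) (V k o)%:E.
    rewrite {1}A12 ge0_integral_setU//=; last 2 first.
    - by move=> o _; rewrite lee_fin.
    - by apply/disj_setPS => o [[_ /= h] [_ /=]]; rewrite ltNge h.
  rewrite IA.
  have P1 : lam%:E * P A1 <= \int[P]_(o in A1) (V k o)%:E.
    rewrite -integral_cst//; apply: ge0_le_integral => //= [x _|x [_ lx]].
      by rewrite lee_fin ltW.
    by rewrite lee_fin.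
  rewrite -addeA; apply: leeD => //.
  apply: (le_trans IH2); apply: (le_trans (leeD2r _ D2)).
  rewrite -addeA leeD2l//.
  rewrite [in leRHS]big_ltn; last by rewrite addnS ltnS leq_addr.
  rewrite EFinD ge0_muleDl ?lee_fin ?sumr_ge0// addnS addSn.
  have PA2 : P A2 <= P A by apply: le_measure => //; rewrite ?inE//; exact: subIsetl.
  by apply: leeD; apply: lee_wpmul2l => //; rewrite lee_fin ?sumr_ge0.
Qed.

Let e_tail (t : R) : (0 < t)%R ->
  exists k0, forall k n, (k0 <= k)%N -> (\sum_(k <= i < k + n) e i <= t)%R.
Proof.
move=> t0.
have /cauchy_cvgP/cauchy_seriesP/(_ t t0)[[A B] /= [[a _ aA] [b _ bB]] AB] := e_cvg.
exists (maxn a b) => k n; rewrite geq_max => /andP[ak bk].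
have := AB (k, k + n)%N; rewrite /= => /(_ _)/ltW h.
apply: le_trans (ler_norm _) (h _); split; [exact: aA|apply: bB => /=].
exact: leq_trans bk (leq_addr _ _).
Qed.

Let rho_telescope (eta kappa : R) k1 n : (0 < eta)%R -> (K <= k1)%N ->
  (0 <= kappa)%R ->
  forall eps : R,
  (forall k A, (K <= k)%N -> F k A ->
   \int[P]_(o in A) (V k.+1 o)%:E
     + (rho k * eta)%:E * P (A `&` [set o | eps <= V k o]%R)
   <= \int[P]_(o in A) (V k o)%:E + (e k)%:E * P A) ->
  (forall k, (k1 <= k)%N -> kappa%:E <= P [set o | eps <= V k o]%R) ->
  \int[P]_o (V (k1 + n)%N o)%:E + ((\sum_(k1 <= i < k1 + n) rho i) * (eta * kappa))%:E
    <= \int[P]_o (V k1 o)%:E + (\sum_(k1 <= i < k1 + n) e i)%:E.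
Proof.
move=> eta0 Kk1 kappa0 eps step often; elim: n => [|n IH].
  by rewrite addn0 !big_geq// mul0r adde0.
rewrite addnS !big_nat_recr/= ?leq_addr//.
have := step (k1 + n)%N setT (leq_trans Kk1 (leq_addr _ _)) (F_setT _).
rewrite setTI probability_setT mule1 => step'.
have {}step' : \int[P]_o (V (k1 + n).+1 o)%:E + (rho (k1 + n)%N * (eta * kappa))%:E
    <= \int[P]_o (V (k1 + n)%N o)%:E + (e (k1 + n)%N)%:E.
  apply: le_trans step'; rewrite leeD2l// mulrA EFinM.
  apply: lee_wpmul2l; last exact/often/leq_addr.
  by rewrite lee_fin mulr_ge0// ltW.
rewrite mulrDl !EFinD (addeC (_ * _)%:E) addeA.
apply: (le_trans (leeD2r _ step')).
by rewrite addeAC [leRHS]addeA leeD2r.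
Qed.

(** Otherwise each step from some index on loses at least rho_k * eta * kappa in mean. Since V stays
    nonnegative and the e_k are summable, the partial sums of [rho] would be bounded. *)
Lemma rarely_far (eps kappa : R) k1 : (0 < eps)%R -> (0 < kappa)%R ->
  exists2 k, (k1 <= k)%N & P [set o | eps <= V k o]%R < kappa%:E.
Proof.
move=> eps0 kappa0; apply/not_exists2P => often.
have [eta eta0 step] := descent eps0.
have [k0 ek0] := e_tail ltr01.
(* From [k2] on, V is integrable, the tail sums of [e] are at most 1 (whence the 1 in D + 1 below),
   and the assumed lower bound on the probability holds. *)
pose k2 := maxn K (maxn k0 k1).
have Kk2 : (K <= k2)%N by rewrite leq_maxl.
have k02 : (k0 <= k2)%N by rewrite /k2 !leq_max leqnn orbT.
have k12 : (k1 <= k2)%N by rewrite /k2 !leq_max leqnn !orbT.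
have often2 k : (k2 <= k)%N -> kappa%:E <= P [set o | eps <= V k o]%R.
  move=> k2k; have [|/negP] := often k; first by rewrite (leq_trans k12).
  by rewrite -leNgt.
have IVfin : \int[P]_o (V k2 o)%:E \is a fin_num.
  by rewrite ge0_fin_numE ?V_integrable//; apply: integral_ge0 => o _; rewrite lee_fin.
set D := fine (\int[P]_o (V k2 o)%:E).
have bnd n : (\sum_(k2 <= i < k2 + n) rho i <= (D + 1) / (eta * kappa))%R.
  have := @rho_telescope eta kappa k2 n eta0 Kk2 (ltW kappa0) eps step often2.
  rewrite -(fineK IVfin) -/D -EFinD => h.
  rewrite ler_pdivlMr ?mulr_gt0// -lee_fin.
  apply: le_trans (_ : (D + \sum_(k2 <= i < k2 + n) e i)%:E <= _); last first.
    by rewrite lee_fin lerD2l ek0.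
  apply: le_trans h; rewrite leeDr//.
  by apply: integral_ge0 => o _; rewrite lee_fin.
apply: rho_dvg; apply: nondecreasing_is_cvgn.
  by apply/nondecreasing_seqP => n; rewrite /series /= big_nat_recr//= lerDl.
exists (series rho k2 + (D + 1) / (eta * kappa))%R => _ [n _ <-].
apply: (@le_trans _ _ (series rho (k2 + n)%N)).
  rewrite /series /= [leRHS](@big_cat_nat _ _ _ n)//= ?leq_addl//.
  by rewrite lerDl sumr_ge0.
rewrite /series /= [leLHS](@big_cat_nat _ _ _ k2)//= ?leq_addr//.
by rewrite lerD2l.
Qed.

Let limsup_set (lam : R) : set T :=
  \bigcap_n \bigcup_(j in [set j | (n <= j)%N]) [set o | lam <= V j o]%R.

Let limsup_set_measurable lam : measurable (limsup_set lam).
Proof.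
by apply: bigcap_measurable => // n _; apply: bigcup_measurable => j _;
  exact: F_measurable (F_ge j lam).
Qed.

Lemma limsup_set_negligible (lam : R) : (0 < lam)%R -> P (limsup_set lam) = 0.
Proof.
move=> lam0; apply/eqP; rewrite eq_le measure_ge0 andbT.
apply/lee_addgt0Pr => t t0; rewrite add0e.
(* One share s of t bounds the probability that V k >= lam * s. On the complement, the initial value
   and the tail of [e] each contribute lam * s to the maximal inequality, hence 2 * s after division
   by [lam]. *)
pose s := (t / 3)%R; have s0 : (0 < s)%R by rewrite divr_gt0.
have ls0 : (0 < lam * s)%R by rewrite mulr_gt0.
have [k0 ek0] := e_tail ls0.
have [k kk far] := rarely_far (maxn K k0) ls0 s0.
move: kk; rewrite geq_max => /andP[Kk k0k].
pose A := [set o | V k o < lam * s]%R.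
have FA : F k A by exact: F_lt.
have mA := F_measurable FA.
have mB : measurable [set o | lam * s <= V k o]%R by exact: F_measurable (F_ge k _).
have bnd n : P (A `&` exceeds lam k n) <= (2 * s)%:E.
  rewrite -(@lee_pmul2l _ lam%:E) ?lte_fin//.
  apply: (le_trans (maximal_inequality n lam0 Kk FA)).
  have -> : lam%:E * (2 * s)%:E = (lam * s)%:E + (lam * s)%:E.
    by rewrite -EFinM -EFinD; congr EFin; ring.
  have PA1 : P A <= 1 by exact: probability_le1.
  apply: leeD.
    apply: (@le_trans _ _ (\int[P]_(o in A) (lam * s)%:E)).
      by apply: ge0_le_integral => //= [x _|x /ltW]; rewrite lee_fin// ltW.
    by rewrite integral_cst// -[leRHS]mule1 lee_pmul2l// lte_fin.
  rewrite -[leRHS]mule1; apply: lee_pmul => //; rewrite lee_fin.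
    by rewrite sumr_ge0.
  exact: ek0.
pose E := A `&` \bigcup_n exceeds lam k n.
have mE : measurable E by apply: measurableI => //; exact: bigcupT_measurable.
have PE : P E <= (2 * s)%:E.
  have -> : E = \bigcup_n (A `&` exceeds lam k n) by rewrite /E setI_bigcupr.
  have cvgE : P (A `&` exceeds lam k n) @[n --> \oo] -->
      P (\bigcup_n (A `&` exceeds lam k n)).
    apply: nondecreasing_cvg_mu.
    - by move=> n; exact: measurableI.
    - by apply: bigcupT_measurable => n; exact: measurableI.
    - move=> n m nm; apply/subsetPset; apply: setIS => o [j /= /andP[kj jn] lj].
      by exists j => //=; rewrite kj (leq_trans jn)// leq_add2l.
  rewrite -(cvg_lim _ cvgE)//; apply: lime_le; first exact: cvgP cvgE.
  by near=> n; exact: bnd.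
apply: (@le_trans _ _ (P ([set o | lam * s <= V k o]%R `|` E))).
  apply: le_measure; rewrite ?inE//; first exact: measurableU.
  move=> o /(_ k Logic.I)[j /= kj lj].
  have [far'|near'] := leP (lam * s)%R (V k o); [by left|right; split => //].
  by exists (j - k)%N => //; exists j => //=; rewrite kj subnKC /=.
apply: (le_trans (measureU2 _ mB mE)).
apply: (le_trans (leeD (ltW far) PE)).
by rewrite -EFinD lee_fin /s; lra.
Unshelve. all: by end_near. Qed.

Lemma descent_cvg : {ae P, forall o, V ^~ o @ \oo --> (0 : R)%R}.
Proof.
have neg : P.-negligible (\bigcup_n limsup_set n.+1%:R^-1).
  apply: negligible_bigcup => n; apply/negligibleP => //.
  by apply: limsup_set_negligible; rewrite invr_gt0.
apply: negligibleS neg.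
move=> o /= ncvg; apply: contrapT => oN; apply: ncvg.
apply/cvgrPdist_lt => t t0.
have [n nt] : exists n, (n.+1%:R^-1 < t)%R.
  have [n _ /(_ n (leqnn _))] := near_infty_natSinv_lt (PosNum t0).
  by exists n.
have : ~ limsup_set n.+1%:R^-1 o by move=> lo; apply: oN; exists n.
move=> /existsNP[k /not_implyP[_ nk]].
near=> j; rewrite sub0r normrN ger0_norm//; apply: lt_trans nt.
rewrite ltNge; apply/negP => jn; apply: nk; exists j => //=.
by near: j; exact: nbhs_infty_ge.
Unshelve. all: by end_near. Qed.

End Descent.

(** * Relative entropy and the mirror step *)

Lemma continuous_addr (R : realType) : continuous (fun x : R * R => x.1 + x.2).
Proof. by move=> z; exact: (@pseudometric_normed_Zmodule.add_continuous R R^o z). Qed.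

Section RelativeEntropy.
Context {R : realType} {N : nat}.
Implicit Types (x z u g : 'rV[R]_N).

Lemma ln_le_subr1 (y : R) : 0 < y -> ln y <= y - 1.
Proof.
by move=> y0; rewrite -{1}(subrKC 1 y); apply: le_ln1Dx; rewrite ltrBrDl subrr.
Qed.

Lemma ln_ge_subr1V (y : R) : 0 < y -> 1 - y^-1 <= ln y.
Proof.
move=> y0; have := @ln_le_subr1 y^-1; rewrite invr_gt0 y0 lnV ?posrE// => /(_ isT).
lra.
Qed.

(** With s and t the square roots of x and z, ln (z / x) = 2 ln (t / s) >= 2 (1 - s / t), so the
    right-hand side is at least (t - s)^2, a Hellinger term. As t + s <= 2, (z - x)^2 = (t - s)^2 (t
    + s)^2 is at most 4 times that. The terms - z + x cancel on summation. *)
Lemma entropy_term_ge_sq (x z : R) : 0 < x <= 1 -> 0 <= z <= 1 ->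
  (z - x) ^+ 2 / 4 <= z * ln (z / x) - z + x.
Proof.
move=> /andP[x0 x1] /andP[z0 z1].
have [->|zn0] := eqVneq z 0; first by rewrite mul0r; nra.
have {z0}zp : 0 < z by rewrite lt_neqAle eq_sym zn0.
have xE := sqr_sqrtr (ltW x0); have zE := sqr_sqrtr (ltW zp).
have s0 : 0 < Num.sqrt x by rewrite sqrtr_gt0.
have t0 : 0 < Num.sqrt z by rewrite sqrtr_gt0.
have s1 : Num.sqrt x <= 1 by rewrite -(sqrtr1 R) ler_sqrt.
have t1 : Num.sqrt z <= 1 by rewrite -(sqrtr1 R) ler_sqrt.
move: (Num.sqrt x) (Num.sqrt z) xE zE s0 t0 s1 t1 => s t xE zE s0 t0 s1 t1.
have ts0 : 0 < t / s by rewrite divr_gt0.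
have lnE : ln (z / x) = 2 * ln (t / s).
  by rewrite -xE -zE -expr_div_n lnXn// mulr_natl.
have h := ln_ge_subr1V ts0; rewrite invf_div in h.
have h2 : 2 * z * (1 - s / t) <= z * ln (z / x).
  by rewrite lnE mulrCA mulrA ler_wpM2l// mulr_ge0// ltW.
have h3 : 2 * z * (1 - s / t) = 2 * z - 2 * (s * t).
  by rewrite -zE; field; rewrite gt_eqF.
rewrite h3 in h2.
have h4 : (z - x) ^+ 2 / 4 <= (t - s) ^+ 2.
  rewrite -xE -zE.
  have -> : (t ^+ 2 - s ^+ 2) ^+ 2 / 4 = (t - s) ^+ 2 * (((t + s) / 2) ^+ 2) by field.
  rewrite ler_piMr ?sqr_ge0// expr_le1//; first lra.
  by rewrite divr_ge0// addr_ge0// ltW.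
apply: (le_trans h4); rewrite -xE -zE in h2 *; nra.
Qed.

Lemma KL_ge_sq x z : (forall j, 0 < x 0 j <= 1) -> (forall j, 0 <= z 0 j <= 1) ->
  \sum_j x 0 j = \sum_j z 0 j -> \sum_j (z 0 j - x 0 j) ^+ 2 / 4 <= KL x z.
Proof.
move=> x01 z01 xz.
apply: (@le_trans _ _ (\sum_j (z 0 j * ln (z 0 j / x 0 j) - z 0 j + x 0 j))).
  by apply: ler_sum => j _; exact: entropy_term_ge_sq.
by rewrite big_split/= sumrB -xz subrK.
Qed.

(** An explicit second-order upper bound takes the place of differentiating the entropy at x'. It
    comes from ln y <= y - 1 at y = (x' + h) / x'; when x' + h = 0, both sides are 0. *)
Lemma entropy_term_perturb (x x' h : R) : 0 < x -> 0 < x' -> 0 <= x' + h ->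
  (x' + h) * ln ((x' + h) / x) <= (x' + h) * ln (x' / x) + h + h ^+ 2 / x'.
Proof.
move=> x0 x'0; rewrite le_eqVlt => /predU1P[/esym q0|q0].
  rewrite q0 !mul0r add0r; have -> : h = - x' by lra.
  by rewrite sqrrN expr2 mulfK ?gt_eqF// addNr.
have lnE : ln ((x' + h) / x) = ln (x' / x) + ln ((x' + h) / x').
  rewrite -lnM ?posrE ?divr_gt0//; congr ln; field.
  by rewrite !gt_eqF.
rewrite lnE mulrDr -addrA lerD2l.
have qx0 : 0 < (x' + h) / x' by rewrite divr_gt0.
apply: (le_trans (ler_wpM2l (ltW q0) (ln_le_subr1 qx0))).
by rewrite le_eqVlt; apply/orP; left; apply/eqP; field; rewrite gt_eqF.
Qed.

(** On the segment from x' to u the objective grows by at most t L + t^2 C, where L is the claimed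
    quantity; minimality at x' for small t forces L >= 0. The first-order terms t (u - x') left by
    the entropy sum to 0, as u and x' have the same total. *)
Lemma first_order_optimality (rho : R) g x x' u :
  (forall j, 0 < x 0 j) -> (forall j, 0 < x' 0 j) -> (forall j, 0 <= u 0 j) ->
  \sum_j u 0 j = \sum_j x' 0 j ->
  (forall t : R, 0 < t <= 1 ->
     rho * dot g (x' - x) + KL x x' <=
     rho * dot g (x' + t *: (u - x') - x) + KL x (x' + t *: (u - x'))) ->
  0 <= rho * dot g (u - x') + \sum_j (u 0 j - x' 0 j) * ln (x' 0 j / x 0 j).
Proof.
move=> x0 x'0 u0 sumE opt.
set L := _ + _.
pose C := \sum_j (u 0 j - x' 0 j) ^+ 2 / x' 0 j.
have C0 : 0 <= C by apply: sumr_ge0 => j _; rewrite divr_ge0 ?sqr_ge0// ltW.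
have key (t : R) : 0 < t <= 1 -> 0 <= t * L + t ^+ 2 * C.
  move=> t01; have := opt t t01; rewrite -subr_ge0 => /le_trans; apply.
  have -> : rho * dot g (x' + t *: (u - x') - x)
      = rho * dot g (x' - x) + t * (rho * dot g (u - x')).
    rewrite /dot !mulr_sumr -big_split/=; apply: eq_bigr => j _; rewrite !mxE; ring.
  have KLle : KL x (x' + t *: (u - x')) <= KL x x' +
      t * (\sum_j (u 0 j - x' 0 j) * ln (x' 0 j / x 0 j)) + t ^+ 2 * C.
    have -> : KL x x' + t * (\sum_j (u 0 j - x' 0 j) * ln (x' 0 j / x 0 j))
       + t ^+ 2 * C = \sum_j ((x' 0 j + t * (u 0 j - x' 0 j)) * ln (x' 0 j / x 0 j)
         + t * (u 0 j - x' 0 j) + (t * (u 0 j - x' 0 j)) ^+ 2 / x' 0 j).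
      rewrite !big_split/= -[in RHS]mulr_sumr sumrB sumE subrr mulr0 addr0.
      congr +%R.
        rewrite /KL mulr_sumr -big_split/=; apply: eq_bigr => j _; ring.
      by rewrite /C mulr_sumr; apply: eq_bigr => j _; ring.
    apply: ler_sum => j _; rewrite !mxE; apply: entropy_term_perturb => //.
    have /andP[t0 t1] := t01.
    have -> : x' 0 j + t * (u 0 j - x' 0 j) = (1 - t) * x' 0 j + t * u 0 j by ring.
    by rewrite addr_ge0// mulr_ge0// ?subr_ge0// ltW.
  by rewrite /L; lra.
rewrite leNgt; apply/negP => L0.
(* This makes t C <= - L / 2, so that L + t C <= L / 2 < 0, a contradiction; C + 1 avoids a zero
   denominator. *)
pose t := Num.min 1 (- L / (2 * (C + 1))).
have C1 : 0 < 2 * (C + 1) by lra.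
have t0 : 0 < t by rewrite lt_min ltr01 divr_gt0// oppr_gt0.
have := key t; rewrite t0 ge_min lexx => /(_ isT).
have tC : t * (2 * (C + 1)) <= - L by rewrite -ler_pdivlMr// ge_min lexx orbT.
rewrite expr2 -mulrA -mulrDr pmulr_rge0//; nra.
Qed.

Lemma KL_diff x x' u : (forall j, 0 < x 0 j) -> (forall j, 0 < x' 0 j) ->
  (forall j, 0 <= u 0 j) ->
  KL x u = KL x' u + \sum_j u 0 j * ln (x' 0 j / x 0 j).
Proof.
move=> x0 x'0 u0; rewrite /KL -big_split/=; apply: eq_bigr => j _.
have [->|un0] := eqVneq (u 0 j) 0; first by rewrite !mul0r addr0.
have up : 0 < u 0 j by rewrite lt_neqAle eq_sym un0 u0.
rewrite -mulrDr -lnM ?posrE ?divr_gt0//; congr (_ * ln _).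
by field; rewrite !gt_eqF.
Qed.

Lemma mirror_descent_inequality (rho : R) g x x' u :
  (forall j, 0 < x 0 j <= 1) -> (forall j, 0 < x' 0 j <= 1) ->
  (forall j, 0 <= u 0 j) ->
  \sum_j x 0 j = \sum_j x' 0 j -> \sum_j u 0 j = \sum_j x' 0 j ->
  (forall t : R, 0 < t <= 1 ->
     rho * dot g (x' - x) + KL x x' <=
     rho * dot g (x' + t *: (u - x') - x) + KL x (x' + t *: (u - x'))) ->
  KL x' u <= KL x u + rho * dot g (u - x) + rho ^+ 2 * \sum_j g 0 j ^+ 2.
Proof.
move=> x01 x'01 u0 sumx sumu opt.
have x0 j : 0 < x 0 j by case/andP: (x01 j).
have x'0 j : 0 < x' 0 j by case/andP: (x'01 j).
have := first_order_optimality x0 x'0 u0 sumu opt.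
have x'01' j : 0 <= x' 0 j <= 1 by case/andP: (x'01 j) => /ltW -> ->.
have := KL_ge_sq x01 x'01' sumx.
rewrite (KL_diff x0 x'0 u0).
have -> : \sum_j (u 0 j - x' 0 j) * ln (x' 0 j / x 0 j) =
    \sum_j u 0 j * ln (x' 0 j / x 0 j) - KL x x'.
  by rewrite /KL -sumrB; apply: eq_bigr => j _; rewrite mulrBl.
have -> : rho * dot g (u - x) = rho * dot g (u - x') + rho * dot g (x' - x).
  by rewrite /dot !mulr_sumr -big_split/=; apply: eq_bigr => j _; rewrite !mxE; ring.
(* Entrywise this is the square of (x' - x) / 2 + rho g: the lower bound on V(x, x') pays for
   replacing x' by x in the linear term, at the cost of rho^2 |g|^2. *)
have : 0 <= rho * dot g (x' - x) + \sum_j (x' 0 j - x 0 j) ^+ 2 / 4 +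
    rho ^+ 2 * \sum_j g 0 j ^+ 2.
  rewrite /dot !mulr_sumr -!big_split/=; apply: sumr_ge0 => j _; rewrite !mxE.
  have -> : rho * (g 0 j * (x' 0 j - x 0 j)) + (x' 0 j - x 0 j) ^+ 2 / 4 +
    rho ^+ 2 * g 0 j ^+ 2 = ((x' 0 j - x 0 j) / 2 + rho * g 0 j) ^+ 2 by field.
  exact: sqr_ge0.
lra.
Qed.

(** Each ratio u_j / x_j is at most 1 / c. With the lower bound of (A6) as c, this makes V
    integrable at each iteration. *)
Lemma KL_le_lnV x u (c : R) : 0 < c <= 1 -> (forall j, c <= x 0 j) ->
  (forall j, 0 <= u 0 j <= 1) -> KL x u <= (\sum_j u 0 j) * ln c^-1.
Proof.
move=> /andP[c0 c1] cx u01; rewrite /KL mulr_suml; apply: ler_sum => j _.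
have /andP[u0 u1] := u01 j.
have [->|un0] := eqVneq (u 0 j) 0; first by rewrite !mul0r.
have up : 0 < u 0 j by rewrite lt_neqAle eq_sym un0 u0.
have xp : 0 < x 0 j by rewrite (lt_le_trans c0).
rewrite ler_wpM2l// ler_ln ?posrE ?divr_gt0 ?invr_gt0//.
by rewrite -[leRHS]mul1r; apply: ler_pM => //; rewrite ?invr_ge0 ?(ltW xp)// lef_pV2.
Qed.

(** Zero entries of u do no harm: their terms vanish identically in x. For the others, u_j / x_j
    tends to 1. *)
Lemma cvg_KL u : (forall j, 0 <= u 0 j) -> KL x u @[x --> u] --> 0.
Proof.
move=> u0; have -> : 0 = \sum_(j < N) (0 : R) by rewrite big1.
rewrite /KL; 
apply: (@cvg_big R _ +%R 0 xpredT (@continuous_addr R) _ (nbhs u) _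
  (fun j x => u 0 j * ln (u 0 j / x 0 j)) (fun=> 0)) => j _.
have [->|un0] := eqVneq (u 0 j) 0.
  by rewrite (_ : (fun _ => _) = cst 0); [exact: cvg_cst|apply/funext => x; rewrite mul0r].
have up : 0 < u 0 j by rewrite lt_neqAle eq_sym un0 u0.
rewrite -(mulr0 (u 0 j)); apply: cvgMl_tmp.
rewrite -(@ln1 R) -(divff un0).
apply: (@continuous_cvg _ _ _ _ _ (fun x : 'rV[R]_N => u 0 j / x 0 j)).
  by apply: continuous_ln; rewrite divff.
apply: cvgMl_tmp; apply: cvgV => //; exact: coord_continuous.
Qed.

End RelativeEntropy.

(** * Borel measurability of block vectors *)

Section BorelVectors.
Context {R : realType} {N : nat}.
Local Notation bvec := (borelV R N).

Lemma measurable_coord (k : 'I_N) :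
  measurable_fun [set: bvec] (fun p : bvec => (p : 'rV[R]_N) 0 k).
Proof.
apply: (measurability _ (RGenOInfty.measurableE R)) => _ /= [_ [r ->] <-].
rewrite setTI; apply: sub_sigma_algebra.
have /continuousP := @coord_continuous R 1 N 0 k.
by apply; exact: interval_open.
Qed.

Lemma closed_measurable_borelV (A : set 'rV[R]_N) : closed A ->
  measurable (A : set bvec).
Proof.
move=> cA; rewrite -(setCK A); apply: measurableC; apply: sub_sigma_algebra.
exact: closed_openC.
Qed.

(** Boxes with rational centre and radius 1 / (n + 1) form a countable basis. The radius is below e
    / 2, since x and y are compared through the centre. *)
Lemma rational_box (O : set 'rV[R]_N) (x : 'rV[R]_N) : open O -> O x ->
  exists q : 'rV[rat]_N * nat,
    (forall k, `|ratr (q.1 0 k) - x 0 k| < q.2.+1%:R^-1) /\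
    [set y : 'rV[R]_N | forall k, `|ratr (q.1 0 k) - y 0 k| < q.2.+1%:R^-1] `<=` O.
Proof.
move=> /[swap] Ox; rewrite openE => /(_ _ Ox) /nbhs_ballP[e /= e0 eO].
have [n ne] : exists n, n.+1%:R^-1 < e / 2.
  have e20 : 0 < e / 2 by rewrite divr_gt0.
  have [n _ /(_ n (leqnn _))] := near_infty_natSinv_lt (PosNum e20).
  by exists n.
have n0 : 0 < (n.+1%:R^-1 : R) by rewrite invr_gt0.
have /choice[q qx] : forall k, exists r : rat, `|ratr r - x 0 k| < n.+1%:R^-1.
  move=> k.
  have xlt : x 0 k - n.+1%:R^-1 < x 0 k + n.+1%:R^-1 by rewrite ltrBlDr -addrA ltrDl addr_gt0.
  have [r] := rat_in_itvoo xlt.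
  rewrite in_itv/= => /andP[h1 h2]; exists r; by rewrite ltr_norml ltrBrDl h1 /= ltrBlDl.
exists (\row_k q k, n); split => [k|y /= yq]; first by rewrite /= mxE.
apply: eO; split => // i k; rewrite ord1 /ball /=.
have := yq k; rewrite mxE => hy; have := qx k => hx.
rewrite (_ : x 0 k - y 0 k = (ratr (q k) - y 0 k) - (ratr (q k) - x 0 k)); last by ring.
apply: (le_lt_trans (ler_normB _ _)); apply: (lt_trans (ltrD hy hx)).
by rewrite [ltRHS](splitr e) ltrD.
Qed.

Lemma measurable_borelV d (T : measurableType d) (f : T -> 'rV[R]_N) :
  (forall k, measurable_fun setT (fun t => f t 0 k)) ->
  measurable_fun setT (f : T -> bvec).
Proof.
move=> mf; apply: (@measurability _ _ T (g_sigma_algebraType (@open 'rV[R]_N)) setT f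
  (@open 'rV[R]_N)) => //.
move=> ? [/= B oB <-]; rewrite setTI.
pose box (q : 'rV[rat]_N * nat) : set T :=
  \bigcap_(k in [set: 'I_N]) (fun t => f t 0 k) @^-1`
     (ball (ratr (q.1 0 k) : R) q.2.+1%:R^-1).
have mbox q : measurable (box q).
  apply: fin_bigcap_measurable => // k _; rewrite -[X in measurable X]setTI.
  by apply: mf => //; exact: measurable_ball.
(* The preimage of the open set is the countable union of the box preimages that it contains. *)
pose inside q := forall t, box q t -> B (f t).
rewrite (_ : f @^-1` B = \bigcup_q (if `[< inside q >] then box q else set0)).
  apply: countable_bigcupT_measurable => [|q]; first exact: countableP.
  by case: ifPn.
apply/seteqP; split => [t Bft|t [q _]]; last by case: asboolP => // h; exact: h.
have [q [qx qO]] := rational_box oB Bft.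
exists q => //; case: asboolP => [_|]; first by move=> k _; exact: qx.
by case=> s bs; apply: qO => k; exact: bs.
Qed.

End BorelVectors.

Lemma measurable_bigmin d (T : measurableType d) (R : realType) (I : Type)
    (r : seq I) (f : I -> T -> R) :
  (forall i, measurable_fun setT (f i)) ->
  measurable_fun setT (fun t => \big[Num.min/1]_(i <- r) f i t).
Proof.
move=> mf; elim: r => [|i r IH].
  by under eq_fun do rewrite big_nil; exact: measurable_cst.
by under eq_fun do rewrite big_cons; exact: measurable_minr.
Qed.

Lemma measurable_sum_fun d (T : measurableType d) (R : realType) (I : Type)
    (r : seq I) (f : I -> T -> R) :
  (forall i, measurable_fun setT (f i)) ->
  measurable_fun setT (fun t => \sum_(i <- r) f i t).
Proof.
move=> mf; elim: r => [|i r IH].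
  by under eq_fun do rewrite big_nil; exact: measurable_cst.
by under eq_fun do rewrite big_cons; exact: measurable_funD.
Qed.

(** The inverse is x times the power -1 of x^2; the identity persists at 0, where both sides are
    0. *)
Lemma measurable_invr (R : realType) : measurable_fun [set: R] (@GRing.inv R).
Proof.
have -> : @GRing.inv R = (fun x => x * (x ^+ 2) `^ (-1)).
  apply/funext => x; rewrite powR_inv1 ?sqr_ge0//.
  have [->|x0] := eqVneq x 0; first by rewrite invr0 mul0r.
  by rewrite expr2 invfM mulrA divff// mul1r.
apply: measurable_funM => //; apply: (measurableT_comp (measurable_powR (-1))).
exact: measurable_funX.
Qed.

Section BlockVectors.
Context {R : realType} {m : nat} {n : 'I_m -> nat}.
Local Notation vec := 'rV[R]_(\sum_(i < m) n i).
Implicit Types p q : vec.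

Lemma submxrow_coord p i (j : 'I_(n i)) : submxrow p i 0 j = p 0 (tagnat.Rank i j).
Proof. by rewrite mxE. Qed.

Lemma sum_blocks (f : 'I_(\sum_(i < m) n i) -> R) :
  \sum_k f k = \sum_(i < m) \sum_(j < n i) f (tagnat.Rank i j).
Proof.
rewrite sig_big_dep/= (reindex _ tagnat.sig_bij_on)/=; apply: eq_bigr => k _.
by rewrite -[in LHS](tagnat.sig2K k).
Qed.

(** The divergence is a sum over entries, so the entropy estimates can be applied to the
    concatenated vector, whose entries lie in [0, 1] and have total m. *)
Lemma blockKL_KL p q : blockKL p q = KL p q.
Proof.
rewrite /KL sum_blocks; apply: eq_bigr => i _; apply: eq_bigr => j _.
by rewrite !submxrow_coord.
Qed.

Lemma block_coordP (Q : R -> Prop) p :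
  (forall k, Q (p 0 k)) <-> (forall i j, Q (submxrow p i 0 j)).
Proof.
split=> [h i j|h k]; first by rewrite submxrow_coord.
have := h (tagnat.sig1 k) (tagnat.sig2 k).
by rewrite submxrow_coord tagnat.sig2K.
Qed.

Lemma prod_simplex_ge0 p k : prod_simplex p -> 0 <= p 0 k.
Proof.
by move=> h; move: k; apply/(block_coordP (fun x => 0 <= x)) => i j; exact: (h i).1.
Qed.

Lemma prod_simplex_le1 p k : prod_simplex p -> p 0 k <= 1.
Proof.
move=> h; move: k; apply/(block_coordP (fun x => x <= 1)) => i j.
by have [h0 <-] := h i; rewrite (bigD1 j)//= lerDl sumr_ge0.
Qed.

Lemma prod_simplex_sum p : prod_simplex p -> \sum_k p 0 k = m%:R.
Proof.
move=> h; rewrite sum_blocks; under eq_bigr => i _.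
  under eq_bigr do rewrite -submxrow_coord.
  rewrite (h i).2; over.
by rewrite sumr_const card_ord.
Qed.

Lemma min_entry_le p k : min_entry p <= p 0 k.
Proof.
move: k; apply/(block_coordP (fun x => min_entry p <= x)) => i j.
rewrite /min_entry (bigD1 i)//= ge_min; apply/orP; left.
by rewrite (bigD1 j)//= ge_min lexx.
Qed.

Lemma min_entry_le1 p : min_entry p <= 1.
Proof.
rewrite /min_entry; elim/big_rec: _ => // i x _ x1.
by rewrite ge_min x1 orbT.
Qed.

Lemma measurable_min_entry :
  measurable_fun [set: borelV R (\sum_(i < m) n i)] (min_entry : vec -> R).
Proof.
rewrite /min_entry; apply: measurable_bigmin => i; apply: measurable_bigmin => j.
have -> : (fun p : borelV R (\sum_(i < m) n i) => submxrow (p : vec) i 0 j) =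
    (fun p : borelV R (\sum_(i < m) n i) => (p : vec) 0 (tagnat.Rank i j)).
  by apply/funext => p; exact: submxrow_coord.
exact: measurable_coord.
Qed.

Lemma measurable_KL u :
  measurable_fun [set: borelV R (\sum_(i < m) n i)] (fun p : vec => KL p u).
Proof.
apply: measurable_sum_fun => k; apply: measurable_funM => //.
apply: (measurableT_comp (@measurable_ln R)); apply: measurable_funM => //.
exact: (measurableT_comp (@measurable_invr R) (measurable_coord k)).
Qed.

Lemma closed_prod_simplex : closed (prod_simplex : set vec).
Proof.
rewrite (_ : prod_simplex = [set p : vec | forall k, 0 <= p 0 k] `&`
   [set p : vec | forall i : 'I_m, \sum_j submxrow p i 0 j = 1]).
  apply: closedI.
    rewrite (_ : mkset _ = \bigcap_k [set p : vec | 0 <= p 0 k]).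
      apply: closed_bigI => k _.
      have /continuous_closedP h := @coord_continuous R 1 (\sum_(i < m) n i) 0 k.
      exact: h _ (@closed_ge R 0).
    by apply/seteqP; split => [p h k _|p h k] /=; exact: h.
  rewrite (_ : mkset _ = \bigcap_i [set p : vec | \sum_j submxrow p i 0 j = 1]).
    apply: closed_bigI => i _.
    have /continuous_closedP h : continuous (fun p : vec => \sum_j submxrow p i 0 j).
      apply: (@continuous_big R _ +%R 0 xpredT (@continuous_addr R) _ _
        (fun j (p : vec) => submxrow p i 0 j)).
      move=> j _; have -> : (fun p : vec => submxrow p i 0 j) =
          (fun p : vec => p 0 (tagnat.Rank i j)).
        by apply/funext => p; exact: submxrow_coord.
      exact: coord_continuous.
    exact: h _ (@closed_eq R 1).
  by apply/seteqP; split => [p h k _|p h k] /=; exact: h.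
apply/seteqP; split => [p h|p [h0 h1] i].
  by split=> [k|i] /=; [exact: prod_simplex_ge0|exact: (h i).2].
by split; [move=> j; rewrite submxrow_coord; exact: h0|exact: h1].
Qed.

End BlockVectors.

(** * Moments of the gradient estimators *)

Section SecondMoment.
Context {d : measure_display} {W : measurableType d} {R : realType} {N : nat}.
Variables (P : probability W R) (X : W -> 'rV[R]_N) (mu : 'rV[R]_N) (v : R).
Hypotheses (mX : forall k, measurable_fun setT (fun w => X w 0 k))
  (muE : forall k, mu 0 k = fine 'E_P[fun w => X w 0 k])
  (var : ('E_P[fun w => (enorm (X w - mu) ^+ 2)%R] <= v%:E)%E).

Let Y k w := X w 0 k - mu 0 k.

Let mY k : measurable_fun setT (Y k).
Proof. exact: measurable_funB. Qed.

Let enormE w : enorm (X w - mu) ^+ 2 = \sum_k Y k w ^+ 2.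
Proof.
rewrite /enorm sqr_sqrtr; last by apply: sumr_ge0 => k _; exact: sqr_ge0.
by apply: eq_bigr => k _; rewrite !mxE.
Qed.

Let int_sum_sqr : (\int[P]_w (\sum_k Y k w ^+ 2)%R%:E <= v%:E)%E.
Proof.
by move: var; rewrite unlock; under eq_integral do rewrite enormE.
Qed.

Let measurable_sum_sqr : measurable_fun setT (fun w => \sum_k Y k w ^+ 2).
Proof. by apply: measurable_sum_fun => k; exact: measurable_funX. Qed.

Let integrable_sum_sqr : P.-integrable setT (EFin \o (fun w => \sum_k Y k w ^+ 2)).
Proof.
apply/integrableP; split; first exact/measurable_EFinP.
under eq_integral => w _.
  rewrite /= ger0_norm; last by apply: sumr_ge0 => k _; exact: sqr_ge0.
  over.
exact: le_lt_trans int_sum_sqr (ltry _).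
Qed.

Let integrable_Y k : P.-integrable setT (EFin \o Y k).
Proof.
apply: (@le_integrable _ _ _ P _ measurableT _
  (EFin \o (fun w => 1 + \sum_k Y k w ^+ 2))).
- exact/measurable_EFinP.
- move=> w _; rewrite /= lee_fin.
  have h : Y k w ^+ 2 <= \sum_k Y k w ^+ 2.
    by rewrite (bigD1 k)//= lerDl sumr_ge0// => j _; exact: sqr_ge0.
  apply: le_trans (ler_norm _).
  have := real_normK (num_real (Y k w)); have := normr_ge0 (Y k w).
  move: (`|Y k w|) h => y h y0 yE; rewrite -yE in h.
  by apply: (@le_trans _ _ (1 + y ^+ 2)); [nra|rewrite lerD2l].
- have -> : EFin \o (fun w => 1 + \sum_k Y k w ^+ 2) =
      (EFin \o cst 1) \+ (EFin \o (fun w => \sum_k Y k w ^+ 2)) by [].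
  apply: integrableD => //; exact: finite_measure_integrable_cst.
Qed.

(** [mu] is the [fine] part of an expectation, which might be a default value. The second-moment
    bound makes Y, hence X, integrable through |y| <= 1 + y^2, so [mu] is the genuine mean. *)
Let E_Y k : (\int[P]_w (Y k w)%:E = 0)%E.
Proof.
have intX : P.-integrable setT (EFin \o (fun w => X w 0 k)).
  have -> : EFin \o (fun w => X w 0 k) = (EFin \o Y k) \+ (EFin \o cst (mu 0 k)).
    by apply/funext => w /=; rewrite -EFinD subrK.
  by apply: integrableD => //; exact: finite_measure_integrable_cst.
have -> : (\int[P]_w (Y k w)%:E =
    \int[P]_w (X w 0 k)%:E - \int[P]_w (mu 0 k)%:E)%E.
  rewrite -integralB_EFin//; exact: finite_measure_integrable_cst.
rewrite integral_cst// [X in (_ * X)%E](probability_setT P) mule1 muE unlock fineK ?subee//;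
  exact: integrable_fin_num.
Qed.

Let E_linear (b : 'I_N -> R) : (\int[P]_w (\sum_k b k * Y k w)%:E = 0)%E.
Proof.
under eq_integral do rewrite -sumEFin.
rewrite integral_sum//; last first.
  by move=> k; exact: (integrableZl measurableT (b k) (integrable_Y k)).
rewrite big1// => k _.
under eq_integral do rewrite EFinM.
rewrite integralZl//; last exact: integrable_Y.
by rewrite [X in (_ * X)%E](E_Y k) mule0.
Qed.

(** Expanding around the mean, X = mu + Y, leaves a linear form in Y, of mean 0, whose coefficients
    [b] absorb the cross terms 2 r mu, and r |Y|^2, whose mean is at most r v. *)
Lemma integral_quadratic_le (a : 'I_N -> R) (r C : R) : 0 <= r ->
  (\int[P]_w (\sum_k a k * X w 0 k + r * (\sum_k X w 0 k ^+ 2) + C)%:E <=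
   (\sum_k a k * mu 0 k + r * (\sum_k mu 0 k ^+ 2 + v) + C)%:E)%E.
Proof.
move=> r0.
pose C' := \sum_k a k * mu 0 k + r * (\sum_k mu 0 k ^+ 2) + C.
pose b k := a k + r * (2 * mu 0 k).
have fE w : \sum_k a k * X w 0 k + r * (\sum_k X w 0 k ^+ 2) + C =
    \sum_k b k * Y k w + (r * (\sum_k Y k w ^+ 2) + C').
  rewrite /C' !addrA; congr (_ + C).
  rewrite !mulr_sumr -!big_split/=; apply: eq_bigr => k _.
  rewrite /b /Y; ring.
under eq_integral do rewrite fE.
have intL : P.-integrable setT (EFin \o (fun w => \sum_k b k * Y k w)).
  have -> : EFin \o (fun w => \sum_k b k * Y k w) =
     (fun w => \sum_k ((b k)%:E * (Y k w)%:E)%E).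
    by apply/funext => w /=; rewrite sumEFin.
  by apply: (integrable_sum measurableT) => k _;
    exact: (integrableZl measurableT (b k) (integrable_Y k)).
have intS : P.-integrable setT (EFin \o (fun w => r * \sum_k Y k w ^+ 2)).
  by have := integrableZl measurableT r integrable_sum_sqr.
have intC : P.-integrable setT (EFin \o cst C').
  exact: finite_measure_integrable_cst.
have intSC : P.-integrable setT (EFin \o (fun w => r * (\sum_k Y k w ^+ 2) + C')).
  exact: (integrableD measurableT intS intC).
have -> : (\int[P]_w (\sum_k b k * Y k w + (r * (\sum_k Y k w ^+ 2) + C'))%:E =
  \int[P]_w (\sum_k b k * Y k w)%:E + (\int[P]_w (r * (\sum_k Y k w ^+ 2))%:E
    + \int[P]_w C'%:E))%E.
  rewrite -(integralD_EFin _ intS intC)//.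
  by rewrite -(integralD_EFin _ intL intSC).
rewrite integral_cst// [X in (_ * X)%E](probability_setT P) mule1.
rewrite E_linear add0e.
under eq_integral do rewrite EFinM.
rewrite integralZl//.
apply: (@le_trans _ _ (r%:E * v%:E + C'%:E)%E).
  by rewrite leeD2r// lee_wpmul2l// lee_fin.
by rewrite -EFinM -EFinD lee_fin /C' mulrDr; lra.
Qed.

(** With all coefficients 1, this passes to the mean the fact that the entries of the gradient
    estimate sum to 0. *)
Lemma mean_linear (b : 'I_N -> R) (C : R) :
  (forall w, \sum_k b k * X w 0 k = C) -> \sum_k b k * mu 0 k = C.
Proof.
move=> bX.
have := E_linear b.
have YE w : \sum_k b k * Y k w = C - \sum_k b k * mu 0 k.
  by rewrite -(bX w) -sumrB; apply: eq_bigr => k _; rewrite mulrBr.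
under eq_integral do rewrite YE.
rewrite integral_cst// [X in (_ * X)%E](probability_setT P) mule1 => -[] /eqP.
by rewrite subr_eq0 => /eqP.
Qed.

End SecondMoment.

Section Estimation.
Context {R : realType} {m : nat} {n : 'I_m -> nat}.
Context {dW dX : measure_display} {W : measurableType dW}
        {Xi : measurableType dX}.
Local Notation vec := 'rV[R]_(\sum_(i < m) n i).
Local Notation bvec := (borelV R (\sum_(i < m) n i)).
Variables (nu : probability Xi R) (Zhat : vec -> Xi -> R).
Variables (Q : vec -> probability W R).
Variables (delta : nat -> W -> vec) (zeta : nat -> W -> Xi).
Hypotheses (mZhat : measurable_fun [set: (bvec * Xi)%type]
    (fun x : bvec * Xi => Zhat x.1 x.2))
  (mdelta : forall j, measurable_fun [set: W] (delta j : W -> bvec))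
  (mzeta : forall j, measurable_fun [set: W] (zeta j))
  (delta_simplex : forall j w, prod_simplex (delta j w)).

Section Combinations.
Context {dT : measure_display} {T : measurableType dT}.
Variables (X D : T -> vec).
Hypotheses (mX : measurable_fun setT (X : T -> bvec))
  (mD : measurable_fun setT (D : T -> bvec)).

Lemma measurable_forward c :
  measurable_fun setT (fun t => forward c (X t) (D t) : bvec).
Proof.
apply: measurable_borelV => k; rewrite /forward.
have -> : (fun t => ((1 - c) *: X t + c *: D t) 0 k) =
    (fun t => (1 - c) * X t 0 k + c * D t 0 k).
  by apply/funext => t; rewrite !mxE.
by apply: measurable_funD; apply: measurable_funM => //;
  exact: (measurableT_comp (measurable_coord k)).
Qed.

Lemma measurable_backward c :
  measurable_fun setT (fun t => backward c (X t) (D t) : bvec).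
Proof.
apply: measurable_borelV => k; rewrite /backward.
have -> : (fun t => ((1 + c) *: X t - c *: D t) 0 k) =
    (fun t => (1 + c) * X t 0 k - c * D t 0 k).
  by apply/funext => t; rewrite !mxE.
by apply: measurable_funB; apply: measurable_funM => //;
  exact: (measurableT_comp (measurable_coord k)).
Qed.

Lemma measurable_valid_points est c :
  measurable [set t | valid_points est c (X t) (D t)].
Proof.
have mS : measurable (prod_simplex : set bvec).
  by apply: closed_measurable_borelV; exact: closed_prod_simplex.
have mf : measurable [set t | prod_simplex (forward c (X t) (D t))].
  by have := measurable_forward c measurableT mS; rewrite setTI.
have mb : measurable [set t | prod_simplex (backward c (X t) (D t))].
  by have := measurable_backward c measurableT mS; rewrite setTI.
by case: est => //=; exact: measurableI.
Qed.

End Combinations.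

Section Measurability.
Context {dT : measure_display} {T : measurableType dT}.
Variables (X : T -> vec) (Y : T -> W).
Hypotheses (mX : measurable_fun setT (X : T -> bvec)) (mY : measurable_fun setT Y).

Let mXk k : measurable_fun setT (fun t => X t 0 k).
Proof. exact: (measurableT_comp (measurable_coord k) mX). Qed.

Let mdeltaY j : measurable_fun setT (delta j \o Y : T -> bvec).
Proof. exact: (measurableT_comp (mdelta j) mY). Qed.

Let mdeltak j k : measurable_fun setT (fun t => delta j (Y t) 0 k).
Proof. exact: (measurableT_comp (measurable_coord k) (mdeltaY j)). Qed.

Let measurable_evaluation (q : T -> vec) i :
  measurable_fun setT (q : T -> bvec) ->
  measurable_fun setT (fun t => Zhat (q t) (zeta i (Y t))).
Proof.
move=> mq.
have mp : measurable_fun setT (fun t => (q t, zeta i (Y t)) : bvec * Xi).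
  by apply: measurable_fun_pair => //; exact: measurableT_comp (mzeta i) mY.
exact: (measurableT_comp mZhat mp).
Qed.

Lemma measurable_slope est c j :
  measurable_fun setT (fun t => slope Zhat est c (X t) (delta j (Y t)) (zeta ^~ (Y t)) j).
Proof.
have mF := measurable_evaluation _ (measurable_forward mX (mdeltaY j) c).
have mB := measurable_evaluation _ (measurable_backward mX (mdeltaY j) c).
have mE := measurable_evaluation _ mX.
by case: est => /=; apply: measurable_funM => //; apply: measurable_funB.
Qed.

Lemma measurable_multiplier gamma0 :
  measurable_fun setT (fun t => multiplier gamma0 (X t)).
Proof.
apply: measurable_funM => //.
apply: (measurableT_comp (@measurable_invr R)).
apply: measurable_funX.
exact: (measurableT_comp measurable_min_entry mX).
Qed.

Lemma measurable_psihat est c reps gamma0 k :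
  measurable_fun setT (fun t =>
    psihat Zhat delta zeta est (X t) c reps (multiplier gamma0 (X t)) (Y t) 0 k).
Proof.
rewrite (_ : (fun _ => _) = (fun t => reps%:R^-1 * \sum_(j < reps)
   (slope Zhat est c (X t) (delta j (Y t)) (zeta ^~ (Y t)) j *
    (multiplier gamma0 (X t) * (delta j (Y t) 0 k - X t 0 k))))).
  apply: measurable_funM => //; apply: measurable_sum_fun => j.
  apply: measurable_funM; first exact: measurable_slope.
  apply: measurable_funM; first exact: measurable_multiplier.
  exact: measurable_funB.
apply/funext => t; rewrite /psihat /grad_estimate !mxE summxE; congr (_ * _).
by apply: eq_bigr => j _; rewrite !mxE.
Qed.

End Measurability.

Lemma psihat_sum0 est p c reps gamma w : prod_simplex p ->
  \sum_k psihat Zhat delta zeta est p c reps gamma w 0 k = 0.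
Proof.
move=> hp; rewrite /psihat /grad_estimate.
under eq_bigr do rewrite mxE summxE.
rewrite -mulr_sumr exchange_big/= big1 ?mulr0// => j _.
under eq_bigr do rewrite !mxE.
rewrite -!mulr_sumr sumrB.
by rewrite (prod_simplex_sum (delta_simplex j w)) (prod_simplex_sum hp) subrr !mulr0.
Qed.

(** All directions have the same law under [Q p], so almost sure feasibility of one of them extends
    to each, and then to countably many together. *)
Lemma valid_points_all est (D : set vec) p c : sampling_model nu Q delta zeta D ->
  D p -> {ae Q p, forall w, valid_points est c p (delta 0%N w)} ->
  {ae Q p, forall w, forall j, valid_points est c p (delta j w)}.
Proof.
case=> _ _ _ _ indep Dp valid0; apply/ae_foralln => j.
pose B : set bvec := [set dl : vec | valid_points est c p dl].
have mB : measurable B.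
  by apply: (measurable_valid_points (X := fun=> p)).
have law_j : Q p (delta j @^-1` ~` B) = Q p (delta 0%N @^-1` ~` B).
  (* With every other factor the full space, the product rule reduces to the equality of the laws of
     [delta j] and [delta 0]. *)
  have := indep p Dp j.+1 (fun i => if i == j then ~` B else setT) (fun=> setT).
  rewrite (_ : _ `&` _ = delta j @^-1` ~` B); last first.
    apply/seteqP; split => [w [/(_ j (ltnSn j)) /=]|w jB]; first by rewrite eqxx.
    by split => // i /= _; case: eqP => [->|].
  move=> -> //; last by move=> i; case: ifP => // _; exact: measurableC.
  rewrite [X in (_ * X)%E]big1 ?mule1; last by move=> i _; exact: probability_setT.
  rewrite big_ord_recr/= eqxx big1 ?mul1e// => i _.
  by rewrite ltn_eqF// preimage_setT; exact: probability_setT.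
have mpre i : measurable (delta i @^-1` ~` B).
  by rewrite -[X in measurable X]setTI; apply: mdelta => //; exact: measurableC.
apply/negligibleP; first exact: mpre.
by rewrite -[LHS]/(Q p (delta j @^-1` ~` B)) law_j; apply/negligibleP.
Qed.

Lemma sqr_enorm N (x : 'rV[R]_N) : enorm x ^+ 2 = \sum_k x 0 k ^+ 2.
Proof. by rewrite sqr_sqrtr// sumr_ge0// => k _; exact: sqr_ge0. Qed.

(** Write mu = g + e + eps0 1, with g the gradient and |e| <= B1 c. In the linear term eps0
    disappears because u - p sums to 0, and e contributes at most |B1| c per entry because |u_k -
    p_k| <= 1. *)
Lemma psihat_descent_bound est Z (D : set vec) gamma0 B1 B2 c0 p u c reps rho :
  bias_variance_bounds Zhat Q delta zeta est Z D gamma0 B1 B2 c0 ->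
  D p -> prod_simplex p -> prod_simplex u -> 0 < c < c0 -> (0 < reps)%N ->
  0 <= rho ->
  {ae Q p, forall w, forall j, valid_points est c p (delta j w)} ->
  (\int[Q p]_w (rho * dot (psihat Zhat delta zeta est p c reps (multiplier gamma0 p) w) (u - p)
     + rho ^+ 2 * (\sum_k psihat Zhat delta zeta est p c reps (multiplier gamma0 p) w 0 k ^+ 2)
     + (\sum_(i < m) n i)%:R)%:E <=
   (rho * dot (grad Z p) (u - p) + rho * ((\sum_(i < m) n i)%:R * (`|B1| * c))
     + rho ^+ 2 * (2 * (B1 * c) ^+ 2 + 2 * (\sum_k grad Z p 0 k ^+ 2)
                   + B2 * (multiplier gamma0 p / (reps%:R * c ^+ 2)))
     + (\sum_(i < m) n i)%:R)%:E)%E.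
Proof.
move=> bounds Dp hp hu c01 reps0 rho0 valid.
set gamma := multiplier gamma0 p.
set N : R := (\sum_(i < m) n i)%:R.
have [[eps0 bias] var] := bounds p c reps Dp c01 reps0 valid.
set X := psihat Zhat delta zeta est p c reps gamma.
set mu := psi Zhat Q delta zeta est p c reps gamma in bias var *.
set v := B2 * _.
have mX k : measurable_fun setT (fun w => X w 0 k).
  exact: (measurable_psihat (X := fun=> p) (Y := id)).
have muE k : mu 0 k = fine 'E_(Q p)[fun w => X w 0 k] by rewrite mxE.
have mu0 : \sum_k mu 0 k = 0.
  have sum1 (x : vec) : \sum_k 1 * x 0 k = \sum_k x 0 k.
    by apply: eq_bigr => k _; rewrite mul1r.
  rewrite -sum1; apply: (mean_linear mX muE var) => w.
  by rewrite sum1; exact: psihat_sum0.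
have := @integral_quadratic_le _ _ _ _ _ X mu v mX muE var
  (fun k => rho * (u - p) 0 k) (rho ^+ 2) N (sqr_ge0 _).
under eq_integral => w _.
  rewrite (_ : \sum_k rho * (u - p) 0 k * X w 0 k = rho * dot (X w) (u - p)); last first.
    by rewrite /dot mulr_sumr; apply: eq_bigr => k _; ring.
  over.
move/le_trans; apply; rewrite lee_fin lerD2r.
set g := grad Z p.
pose e : vec := mu - g - const_mx eps0.
have eE k : e 0 k = mu 0 k - g 0 k - eps0 by rewrite !mxE.
have eB : \sum_k e 0 k ^+ 2 <= (B1 * c) ^+ 2.
  rewrite -sqr_enorm; have : 0 <= enorm e by exact: sqrtr_ge0.
  by move=> e0; rewrite ler_sqr ?nnegrE//; exact: le_trans bias.
have ek k : `|e 0 k| <= `|B1| * c.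
  have c0' : 0 < c by case/andP: c01.
  rewrite -(ger0_norm (ltW c0')) -normrM -ler_sqr ?nnegrE// !real_normK ?num_real//.
  by apply: le_trans eB; rewrite (bigD1 k)//= lerDl sumr_ge0// => j _; exact: sqr_ge0.
have sum_up : \sum_k (u - p) 0 k = 0.
  under eq_bigr do rewrite !mxE.
  by rewrite sumrB (prod_simplex_sum hu) (prod_simplex_sum hp) subrr.
have -> : \sum_k rho * (u - p) 0 k * mu 0 k =
    rho * dot g (u - p) + rho * (\sum_k e 0 k * (u - p) 0 k).
  rewrite -mulrDr /dot -big_split/=.
  transitivity (rho * (\sum_k (g 0 k * (u - p) 0 k + e 0 k * (u - p) 0 k) +
    eps0 * \sum_k (u - p) 0 k)); last by rewrite sum_up mulr0 addr0.
  rewrite [eps0 * _]mulr_sumr -big_split/= mulr_sumr; apply: eq_bigr => k _.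
  by rewrite eE; ring.
have up1 k : `|(u - p) 0 k| <= 1.
  have := prod_simplex_ge0 k hp; have := prod_simplex_le1 k hp.
  have := prod_simplex_ge0 k hu; have := prod_simplex_le1 k hu.
  by rewrite !mxE ler_norml; lra.
apply: lerD.
  rewrite lerD2l ler_wpM2l// (le_trans (ler_norm _))// (le_trans (ler_norm_sum _ _ _))//.
  rewrite /N -[in leRHS](card_ord (\sum_(i < m) n i)) mulr_natl -sumr_const.
  apply: ler_sum => k _; rewrite normrM -[leRHS]mulr1.
  exact: ler_pM.
rewrite ler_wpM2l ?sqr_ge0// lerD2r.
(* As mu is orthogonal to the all-ones vector, subtracting eps0 from every entry can only increase
   the norm; what remains is |e + g|^2 <= 2 |e|^2 + 2 |g|^2. *)
apply: (@le_trans _ _ (\sum_k (mu 0 k - eps0) ^+ 2)).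
  have -> : \sum_k (mu 0 k - eps0) ^+ 2 =
      \sum_k mu 0 k ^+ 2 - 2 * eps0 * (\sum_k mu 0 k) + \sum_(k < \sum_(i < m) n i) eps0 ^+ 2.
    rewrite mulr_sumr -sumrB -big_split/=; apply: eq_bigr => k _; ring.
  by rewrite mu0 mulr0 subr0 lerDl sumr_ge0// => k _; exact: sqr_ge0.
apply: (@le_trans _ _ (\sum_k (2 * e 0 k ^+ 2 + 2 * g 0 k ^+ 2))).
  apply: ler_sum => k _; rewrite (_ : mu 0 k - eps0 = e 0 k + g 0 k); last by rewrite eE; ring.
  rewrite -subr_ge0 (_ : _ - _ = (e 0 k - g 0 k) ^+ 2); last by ring.
  exact: sqr_ge0.
by rewrite big_split/= -!mulr_sumr lerD2r ler_wpM2l.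
Qed.

End Estimation.

(** * Step sizes *)

Section PowerSeries.
Context {R : realType}.

(** The ratio of y^-t to (y + 1)^-t is exp (t ln ((y + 1) / y)), which is at least 1 + t / (y + 1).
    Summation over y bounds the series of exponent 1 + t by a telescoping one. *)
Lemma powR_telescope (t y : R) : 0 < t -> 0 < y ->
  t * ((y + 1) `^ (1 + t))^-1 <= (y `^ t)^-1 - ((y + 1) `^ t)^-1.
Proof.
move=> t0 y0.
have y10 : 0 < y + 1 by lra.
set Y := (y + 1) `^ t; have Y0 : 0 < Y by rewrite powR_gt0.
have YE : (y + 1) `^ (1 + t) = (y + 1) * Y.
  by rewrite powRD ?(gt_eqF y10) ?implybT// powRr1// ltW.
have -> : (y `^ t)^-1 = Y^-1 * expR (t * (ln (y + 1) - ln y)).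
  rewrite -!powRN /powR !gt_eqF// -expRD; congr expR; ring.
rewrite -[X in _ <= _ - X]mulr1 -mulrBr YE invfM mulrA mulrC ler_pM2l ?invr_gt0//.
rewrite lerBrDl; apply: le_trans (expR_ge1Dx _); rewrite lerD2l ler_pM2l//.
have yy0 : 0 < (y + 1) / y by rewrite divr_gt0.
have := ln_ge_subr1V yy0; rewrite invf_div ln_div ?posrE//; apply: le_trans.
by rewrite le_eqVlt; apply/orP; left; apply/eqP; field; rewrite gt_eqF.
Qed.

Lemma cvg_power_series (s : R) : 1 < s -> cvgn (series (fun k => (k.+1%:R `^ s)^-1)).
Proof.
move=> s1; pose t := s - 1; have t0 : 0 < t by rewrite /t; lra.
have sE : s = 1 + t by rewrite /t; ring.
have u0 k : 0 <= (k.+1%:R `^ s)^-1 :> R by rewrite invr_ge0 powR_ge0.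
have bnd n : series (fun k => (k.+1%:R `^ s)^-1) n.+1 <=
    1 + t^-1 * (1 - (n.+1%:R `^ t)^-1).
  elim: n => [|n IH].
    by rewrite /series/= big_nat1 !powR1 invr1 subrr mulr0 addr0.
  rewrite /series/= big_nat_recr//=.
  have := @powR_telescope t n.+1%:R t0 (ltr0Sn _ _).
  rewrite natr1 -sE mulrC -ler_pdivlMr// mulrC mulrBr => h.
  by apply: (le_trans (lerD IH h)); rewrite !mulrBr; lra.
apply: nondecreasing_is_cvgn.
  by apply/nondecreasing_seqP => n; rewrite /series /= big_nat_recr//= lerDl.
exists (1 + t^-1) => _ [n _ <-].
apply: (@le_trans _ _ (series (fun k => (k.+1%:R `^ s)^-1) n.+1)).
  by rewrite /series /= big_nat_recr//= lerDl.
by apply: (le_trans (bnd n)); rewrite lerD2l -[leRHS]mulr1 ler_pM2l ?invr_gt0.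
Qed.

Lemma power_decay_sqr (a s : R) k : power_decay a s k.+1 ^+ 2 =
  a ^+ 2 * (k.+1%:R `^ (2 * s))^-1.
Proof.
by rewrite /power_decay expr_div_n mulrC [2 * s]mulrC powRrM powR_mulrn ?powR_ge0// mulrC.
Qed.

Lemma power_decayM (a b s t : R) k : power_decay a s k.+1 * power_decay b t k.+1 =
  a * b * (k.+1%:R `^ (s + t))^-1.
Proof.
rewrite /power_decay powRD; last by rewrite pnatr_eq0 implybT.
by rewrite invfM; ring.
Qed.

Lemma power_decay_lt (b theta c0 : R) : 0 < b -> 0 < theta -> 0 < c0 ->
  exists K, forall k, (K <= k)%N -> power_decay b theta k.+1 < c0.
Proof.
move=> b0 th0 c00.
have x0 : 0 <= (b / c0) `^ theta^-1 by exact: powR_ge0.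
exists (Num.truncn ((b / c0) `^ theta^-1)) => k Kk.
have lt_k : (b / c0) `^ theta^-1 < k.+1%:R.
  by case/andP: (truncn_itv x0) => _ /lt_le_trans; apply; rewrite ler_nat ltnS.
have bc0 : 0 <= b / c0 by rewrite divr_ge0// ltW.
rewrite /power_decay ltr_pdivrMr ?powR_gt0// -ltr_pdivrMl// mulrC.
rewrite -[ltLHS](powRr1 bc0) -[X in _ `^ X < _](mulVf (lt0r_neq0 th0)) powRrM.
by apply: gt0_ltr_powR; rewrite ?nnegrE.
Qed.

(** Origin of the third exponent: the step size gives k^-(2 alpha), the multiplier at most k^(2 d)
    through (A6), the replications at least k^beta in the denominator, and the division by c_k^2
    gives k^(2 theta). *)
Lemma variance_decay (a alpha b theta R0 beta Abar d gamma0 B2 y : R) k :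
  0 < b -> 0 < R0 -> 0 < Abar -> 0 < gamma0 ->
  power_decay Abar d k.+1 <= y ->
  power_decay a alpha k.+1 ^+ 2 * (B2 * (gamma0 * y ^- 2 /
    ((replications R0 beta k.+1)%:R * power_decay b theta k.+1 ^+ 2))) <=
  a ^+ 2 * `|B2| * gamma0 / (Abar ^+ 2 * R0 * b ^+ 2) *
    (k.+1%:R `^ (2 * alpha + beta - 2 * d - 2 * theta))^-1.
Proof.
move=> b0 R00 A0 g0 Ay.
have k0 : 0 < k.+1%:R :> R by rewrite ltr0Sn.
have pd0 : 0 < power_decay Abar d k.+1 by rewrite divr_gt0// powR_gt0.
have y0 : 0 < y by exact: lt_le_trans pd0 Ay.
have powE : k.+1%:R `^ (2 * alpha + beta - 2 * d - 2 * theta) =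
    (k.+1%:R `^ alpha) ^+ 2 * k.+1%:R `^ beta /
      ((k.+1%:R `^ d) ^+ 2 * (k.+1%:R `^ theta) ^+ 2) :> R.
  rewrite -!powR_mulrn ?powR_ge0// -!powRrM /powR gt_eqF//.
  rewrite -!expRD -expRN -expRD; congr expR; ring.
have rep : R0 * k.+1%:R `^ beta <= (replications R0 beta k.+1)%:R.
  have x0 : 0 <= R0 * k.+1%:R `^ beta by rewrite mulr_ge0 ?powR_ge0// ltW.
  by case/andP: (truncn_itv x0) => _ /ltW.
have yV : y ^- 2 <= (power_decay Abar d k.+1) ^- 2.
  by rewrite lef_pV2 ?posrE ?exprn_gt0// ler_sqr// nnegrE ltW.
rewrite powE /power_decay in yV *.
have ka0 : 0 < k.+1%:R `^ alpha :> R by rewrite powR_gt0.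
have kb0 : 0 < k.+1%:R `^ beta :> R by rewrite powR_gt0.
have kd0 : 0 < k.+1%:R `^ d :> R by rewrite powR_gt0.
have kt0 : 0 < k.+1%:R `^ theta :> R by rewrite powR_gt0.
move: (k.+1%:R `^ alpha) (k.+1%:R `^ beta) (k.+1%:R `^ d) (k.+1%:R `^ theta)
  ka0 kb0 kd0 kt0 rep yV => A B D T ka0 kb0 kd0 kt0 rep yV.
move: (replications _ _ _)%:R rep => r rep.
have RB0 : 0 < R0 * B by rewrite mulr_gt0.
have r0 : 0 < r by exact: lt_le_trans rep.
have -> : a ^+ 2 * `|B2| * gamma0 / (Abar ^+ 2 * R0 * b ^+ 2) *
   (A ^+ 2 * B / (D ^+ 2 * T ^+ 2))^-1 =
   (a / A) ^+ 2 * (`|B2| * (gamma0 * (Abar / D) ^- 2 / (R0 * B * (b / T) ^+ 2))).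
  by field; rewrite !gt_eqF.
have bT : 0 < (b / T) ^+ 2 by rewrite exprn_gt0// divr_gt0.
rewrite ler_wpM2l ?sqr_ge0//.
have h0 : 0 <= gamma0 * y ^- 2 / (r * (b / T) ^+ 2).
  by rewrite divr_ge0 ?mulr_ge0 ?invr_ge0 ?exprn_ge0// ltW.
apply: (le_trans (ler_wpM2r h0 (ler_norm B2))).
apply: ler_wpM2l => //; apply: ler_pM.
- by rewrite mulr_ge0 ?invr_ge0 ?exprn_ge0// ltW.
- by rewrite invr_ge0 mulr_ge0// ltW.
- by rewrite ler_pM2l.
- have p1 : 0 < r * (b / T) ^+ 2 by exact: mulr_gt0.
  have p2 : 0 < R0 * B * (b / T) ^+ 2 by exact: mulr_gt0.
  by rewrite lef_pV2 ?posrE//; exact: ler_wpM2r (ltW bT) _ _ rep.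
Qed.

End PowerSeries.

(** * Geometry of the feasible set *)

Section FeasibleSet.
Context {R : realType} {m : nat} {n : 'I_m -> nat}.
Local Notation vec := 'rV[R]_(\sum_(i < m) n i).
Variable U_ : forall i : 'I_m, set 'rV[R]_(n i).
Arguments U_ : clear implicits.
Hypothesis U_simplex : forall i, U_ i `<=` simplex (n i).

Lemma block_prod_simplex (p : vec) : block_prod U_ p -> prod_simplex p.
Proof. by move=> Up i; exact/U_simplex/Up. Qed.

Lemma block_prod_segment (x y : vec) (t : R) : (forall i, convex_set (U_ i)) ->
  block_prod U_ x -> block_prod U_ y -> 0 < t <= 1 ->
  block_prod U_ (x + t *: (y - x)).
Proof.
move=> U_convex Ux Uy /andP[t0 t1] i.
have := U_convex i (submxrow y i) (submxrow x i) (Itv01 (ltW t0) t1).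
rewrite !inE => /(_ (Uy i) (Ux i)); rewrite /conv/=.
congr (U_ i _); apply/rowP => j; rewrite !mxE.
by rewrite /unstable.onem; ring.
Qed.

Lemma submxrow_continuous i : continuous (fun p : vec => submxrow p i).
Proof.
move=> p B /nbhs_ballP[e e0 eB]; apply/nbhs_ballP; exists e => // q [_ pq].
by apply: eB; split => // a j; rewrite !mxE; exact: pq.
Qed.

Lemma closed_block_prod : (forall i, compact (U_ i)) -> closed (block_prod U_ : set vec).
Proof.
move=> U_compact.
rewrite (_ : block_prod U_ = \bigcap_i [set p : vec | U_ i (submxrow p i)]); last first.
  by apply/seteqP; split => [p h i _|p h i]; exact: h.
apply: closed_bigI => i _.
have /continuous_closedP h := @submxrow_continuous i.
by apply: h; apply: compact_closed => //; exact: norm_hausdorff.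
Qed.

(** A closed subset of the cube [0, 1]^N, whose compactness is known in coordinates of the
    concatenated vector. *)
Lemma compact_block_prod : (forall i, compact (U_ i)) -> compact (block_prod U_ : set vec).
Proof.
move=> U_compact.
have box : compact [set v : vec | forall k, `[0 : R, 1]%classic (v ord0 k)].
  by apply: (@rV_compact R _ (fun=> `[0 : R, 1]%classic)) => _; exact: segment_compact.
apply: subclosed_compact (closed_block_prod U_compact) box _.
move=> p /block_prod_simplex hp i; rewrite /= in_itv/=.
by rewrite (prod_simplex_ge0 i hp) (prod_simplex_le1 i hp).
Qed.

Lemma within_continuous_descent_rate (A : set vec) (G : vec -> vec) (u : vec) :
  {within A, continuous G} -> {within A, continuous (fun q => dot (G q) (q - u))}.
Proof.
move=> cG x; rewrite /dot.
apply: (@cvg_big R _ +%R 0 xpredT (@continuous_addr R) _ (nbhs (x : subspace A)) _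
  (fun k (q : subspace A) => G q 0 k * (q - u) 0 k)
  (fun k => G x 0 k * (x - u) 0 k)) => k _.
apply: cvgM.
  by apply: (cvg_comp G (fun v : vec => v 0 k) (cG x)); exact: coord_continuous.
have cB : continuous (fun q : vec => (q - u) 0 k).
  have -> : (fun q : vec => (q - u) 0 k) = (fun q : vec => q 0 k - u 0 k).
    by apply/funext => q; rewrite !mxE.
  move=> q; have h1 := @coord_continuous R 1 (\sum_(i < m) n i) 0 k q.
  have h2 : cst (u 0 k) @ nbhs q --> u 0 k by exact: cvg_cst.
  exact: (@cvgB R R^o _ _ _ _ _ _ _ h1 h2).
have h : {within A, continuous (fun q : vec => (q - u) 0 k)} by exact: continuous_subspaceT.
exact: (h x).
Qed.

(** [KL] jumps where its first argument acquires a zero entry, so the set of q with KL q u >= eps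
    may fail to be closed. It is enlarged to the part of the feasible set outside an open
    neighbourhood of u on which KL < eps. The image of this compact set is closed and misses 0; the
    radius of a ball around 0 avoiding it is [eta]. *)
Lemma descent_rate_away (Z : vec -> R) (u : vec) (eps : R) :
  (forall i, compact (U_ i)) ->
  {within prod_simplex, continuous (grad Z)} ->
  (forall k, 0 <= u 0 k) ->
  (forall q, block_prod U_ q -> q != u -> 0 < dot (grad Z q) (q - u)) ->
  0 < eps ->
  exists2 eta, 0 < eta & forall q, block_prod U_ q -> eps <= KL q u ->
    eta <= dot (grad Z q) (q - u).
Proof.
move=> U_compact cgrad u0 pos eps0.
have /cvgrPdist_lt/(_ _ eps0) near_u := cvg_KL u0.
pose O := [set q : vec | `|0 - KL q u| < eps]^°.
pose K := block_prod U_ `&` ~` O.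
have cK : compact K.
  apply: compact_closedI; first exact: compact_block_prod.
  by apply: open_closedC; exact: open_interior.
have cphi : {within K, continuous (fun q => dot (grad Z q) (q - u))}.
  apply: within_continuous_descent_rate.
  apply: continuous_subspaceW cgrad => q [Uq _]; exact: block_prod_simplex.
have cimg := continuous_compact cphi cK.
have /compact_closed/closed_openC := cimg; move/(_ (@norm_hausdorff _ _)).
rewrite openE => /(_ 0) [].
  move=> [q [Uq Oq] q0].
  have := pos q Uq; rewrite q0 ltxx => /(_ _)/eqP/negPf h.
  have qu : q != u by apply: contra_notN Oq => /eqP ->.
  by have := h qu.
move=> e /= e0 he; exists e => // q Uq Kq.
have Oq : (~` O) q.
  move=> /interior_subset /=; rewrite sub0r normrN => h.
  by have := le_lt_trans (ler_norm _) h; rewrite ltNge Kq.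
rewrite leNgt; apply/negP => lt_e.
have qu : q != u by apply: contra_notN Oq => /eqP ->.
apply: (he (dot (grad Z q) (q - u))); last by exists q.
by rewrite /ball/= sub0r normrN gtr0_norm// pos.
Qed.

(** The Lipschitz bound relative to the reference point u suffices, since |p - u|^2 is at most the
    number of entries. *)
Lemma grad_bounded (Z : vec -> R) (L0 L1 L2 : R) (u : vec) :
  smooth_lipschitz Z L0 L1 L2 -> prod_simplex u ->
  exists G, forall p, prod_simplex p -> \sum_k grad Z p 0 k ^+ 2 <= G.
Proof.
move=> [_ lip] hu.
exists (2 * (L1 ^+ 2 * (\sum_(i < m) n i)%:R) + 2 * \sum_k grad Z u 0 k ^+ 2) => p hp.
have [_ lipg _] := lip p u hp hu.
have subE (x y : vec) k : (x - y) 0 k = x 0 k - y 0 k by rewrite !mxE.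
apply: (@le_trans _ _ (\sum_k (2 * (grad Z p - grad Z u) 0 k ^+ 2 + 2 * grad Z u 0 k ^+ 2))).
  apply: ler_sum => k _; rewrite subE -subr_ge0.
  rewrite (_ : _ - _ = (grad Z p 0 k - 2 * grad Z u 0 k) ^+ 2); last by ring.
  exact: sqr_ge0.
rewrite big_split/= -!mulr_sumr lerD2r ler_wpM2l//.
rewrite -sqr_enorm.
have e0 : 0 <= enorm (grad Z p - grad Z u) by exact: sqrtr_ge0.
have : enorm (grad Z p - grad Z u) ^+ 2 <= (L1 * enorm (p - u)) ^+ 2.
  by rewrite ler_sqr ?nnegrE//; exact: le_trans lipg.
move/le_trans; apply; rewrite exprMn ler_wpM2l ?sqr_ge0// sqr_enorm.
rewrite -[in leRHS](card_ord (\sum_(i < m) n i)) -sumr_const.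
apply: ler_sum => k _; rewrite !mxE.
have := prod_simplex_ge0 k hp; have := prod_simplex_le1 k hp.
have := prod_simplex_ge0 k hu; have := prod_simplex_le1 k hu; nra.
Qed.

End FeasibleSet.

(** * Convergence *)

Section OneStep.
Context {R : realType} {m : nat} {n : 'I_m -> nat}.
Context {dW dX dO : measure_display} {W : measurableType dW}
        {Xi : measurableType dX} {Omega : measurableType dO}.
Local Notation vec := 'rV[R]_(\sum_(i < m) n i).
Local Notation bvec := (borelV R (\sum_(i < m) n i)).
Variables (nu : probability Xi R) (Zhat : vec -> Xi -> R).
Variables (P : probability Omega R) (Q : vec -> probability W R).
Variables (delta : nat -> W -> vec) (zeta : nat -> W -> Xi).
Hypotheses (mZhat : measurable_fun [set: (bvec * Xi)%type]
    (fun x : bvec * Xi => Zhat x.1 x.2)).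
Variables (X X' : Omega -> vec) (Y : Omega -> W) (A : set Omega).
Hypotheses (mX : measurable_fun setT (X : Omega -> bvec))
  (mX' : measurable_fun setT (X' : Omega -> bvec))
  (mY : measurable_fun setT Y) (mA : measurable A).
Hypothesis conditional_law : forall (B1 : set bvec) (B2 : set W),
  measurable B1 -> measurable B2 ->
  P ((A `&` X @^-1` B1) `&` Y @^-1` B2) =
  (\int[P]_(o in A `&` X @^-1` B1) Q (X o) B2)%E.
Variables (U : set vec) (u : vec).
Hypotheses (sampling : sampling_model nu Q delta zeta (positive_part U))
  (U_simplex : U `<=` prod_simplex) (Uu : U u).
Variables (est : estimator) (Z : vec -> R) (gamma0 B1 B2 c0 c rho : R) (reps : nat).
Hypotheses (bounds : bias_variance_bounds Zhat Q delta zeta est Z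
    (positive_part U) gamma0 B1 B2 c0)
  (c01 : 0 < c < c0) (reps0 : (0 < reps)%N) (rho0 : 0 <= rho).

(** With the default values of [ln] and of the inverse, [KL q u] can be negative when q has zero
    entries. The truncation gives a function nonnegative everywhere, equal to [KL] at positive
    feasible points. *)
Definition entropy_to (q : vec) : R := Num.max 0 (KL q u).

Lemma measurable_entropy_to : measurable_fun [set: bvec] entropy_to.
Proof. by apply: measurable_maxr => //; exact: measurable_KL. Qed.

Let psih q w := psihat Zhat delta zeta est q c reps (multiplier gamma0 q) w.
Let N : R := (\sum_(i < m) n i)%:R.

Let quad q w := rho * dot (psih q w) (u - q) + rho ^+ 2 * (\sum_k psih q w 0 k ^+ 2) + N.

(* Completing the square: the entries of [u - q] lie in [-1, 1]. *)
Let quad_ge0 q w : prod_simplex q -> 0 <= quad q w.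
Proof.
move=> hq; rewrite /quad /dot !mulr_sumr /N -[X in X%:R](card_ord (\sum_(i < m) n i)).
rewrite -sumr_const -!big_split/=; apply: sumr_ge0 => k _.
have subE : (u - q) 0 k = u 0 k - q 0 k by rewrite !mxE.
rewrite subE.
have := prod_simplex_ge0 k hq; have := prod_simplex_le1 k hq.
have := prod_simplex_ge0 k (U_simplex Uu); have := prod_simplex_le1 k (U_simplex Uu).
move: (psih q w 0 k) (u 0 k) (q 0 k) => g y x y1 y0 x1 x0.
have -> : rho * (g * (y - x)) + rho ^+ 2 * g ^+ 2 + 1 =
  (rho * g + (y - x) / 2) ^+ 2 + (1 - ((y - x) / 2) ^+ 2) by field.
by rewrite addr_ge0 ?sqr_ge0// subr_ge0; nra.
Qed.

(** [quad] is known to be nonnegative only over the product of simplices; the truncation makes the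
    integrand nonnegative on the whole product space. *)
Let F (x : bvec * W) : \bar R := (Num.max 0 (quad x.1 x.2))%:E.

Let F_ge0 x : (0 <= F x)%E.
Proof. by rewrite lee_fin le_max lexx. Qed.

Let mF : measurable_fun setT F.
Proof.
case: sampling => _ mdelta mzeta _ _.
have m1 k : measurable_fun [set: bvec * W] (fun x : bvec * W => psih x.1 x.2 0 k).
  exact: (measurable_psihat mZhat mdelta mzeta
    (measurable_fst : measurable_fun setT (fst : bvec * W -> bvec))
    (measurable_snd : measurable_fun setT (snd : bvec * W -> W))
    est c reps gamma0 k).
have m2 k : measurable_fun [set: bvec * W] (fun x : bvec * W => (u - (x.1 : vec)) 0 k).
  have -> : (fun x : bvec * W => (u - (x.1 : vec)) 0 k) =
      (fun x : bvec * W => u 0 k - (x.1 : vec) 0 k).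
    by apply/funext => x; rewrite !mxE.
  apply: measurable_funB => //.
  exact: (measurableT_comp (measurable_coord k) measurable_fst).
apply/measurable_EFinP; apply: measurable_maxr => //.
apply: measurable_funD => //; apply: measurable_funD; apply: measurable_funM => //.
  by apply: measurable_sum_fun => k; exact: measurable_funM.
by apply: measurable_sum_fun => k; exact: measurable_funX.
Qed.

Lemma one_step_descent (e eps eta : R) :
  0 <= e -> 0 < eps -> 0 <= eta ->
  {ae P, forall o, positive_part U (X o)} ->
  {ae P, forall o, positive_part U (X' o)} ->
  {ae P, forall o, {ae Q (X o), forall w, forall j,
     valid_points est c (X o) (delta j w)}} ->
  {ae P, forall o, KL (X' o) u <= KL (X o) u + rho * dot (psih (X o) (Y o)) (u - X o)
     + rho ^+ 2 * (\sum_k psih (X o) (Y o) 0 k ^+ 2)} ->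
  {ae P, forall o, rho * (N * (`|B1| * c))
     + rho ^+ 2 * (2 * (B1 * c) ^+ 2 + 2 * (\sum_k grad Z (X o) 0 k ^+ 2)
       + B2 * (multiplier gamma0 (X o) / (reps%:R * c ^+ 2))) <= e} ->
  (forall q, U q -> 0 <= dot (grad Z q) (q - u)) ->
  (forall q, U q -> eps <= KL q u -> eta <= dot (grad Z q) (q - u)) ->
  (\int[P]_(o in A) (entropy_to (X' o))%:E
     + (rho * eta)%:E * P (A `&` [set o | eps <= entropy_to (X o)]%R)
   <= \int[P]_(o in A) (entropy_to (X o))%:E + e%:E * P A)%E.
Proof.
move=> e0 eps0 eta0 feas feas' valid step err rate0 rate_eta.
have [mQ mdelta mzeta delta_simplex _] := sampling.
have mV (x : Omega -> vec) D : measurable_fun setT (x : Omega -> bvec) ->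
    measurable_fun D (fun o => (entropy_to (x o))%:E).
  move=> mx; apply: measurable_funTS; apply/measurable_EFinP.
  exact: (measurableT_comp measurable_entropy_to mx).
have V0 q : (0 <= (entropy_to q)%:E)%E by rewrite lee_fin le_max lexx.
have N0 : 0 <= N by exact: ler0n.
have mXY : measurable_fun setT (fun o => (X o : bvec, Y o)) by exact: measurable_fun_pair.
have mFXY : measurable_fun setT (fun o => F (X o, Y o)) by exact: measurableT_comp mF mXY.
pose I (o : Omega) := (\int[Q (X o)]_w F (X o, w))%E.
have mI : measurable_fun setT I.
  exact: (measurableT_comp (measurable_kernel_integral mQ F_ge0 mF) mX).
have I0 o : (0 <= I o)%E by exact: integral_ge0.
have mE : measurable [set o | eps <= entropy_to (X o)].
  have := measurableT_comp measurable_entropy_to mX.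
  move=> /(_ measurableT `[eps, +oo[%classic (measurable_itv _)).
  rewrite setTI; congr measurable; apply/seteqP.
  by split => o /=; rewrite in_itv/= andbT.
set E := [set o | _] in mE *.
have KL_ge0 q : positive_part U q -> 0 <= KL q u.
  case=> Uq q0; have hq := U_simplex Uq; have hu := U_simplex Uu.
  apply: le_trans (KL_ge_sq _ _ _); last 3 first.
  - by move=> k; rewrite q0 prod_simplex_le1.
  - by move=> k; rewrite prod_simplex_ge0 ?prod_simplex_le1.
  - by rewrite !prod_simplex_sum.
  by apply: sumr_ge0 => k _; rewrite divr_ge0 ?sqr_ge0.
have VE q : positive_part U q -> entropy_to q = KL q u.
  by move=> /KL_ge0 h; rewrite /entropy_to max_r.
(* The pathwise mirror inequality, integrated over [A] after adding N to both sides. *)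
have path : (\int[P]_(o in A) (entropy_to (X' o))%:E + N%:E * P A <=
    \int[P]_(o in A) (entropy_to (X o))%:E + \int[P]_(o in A) F (X o, Y o))%E.
  rewrite -integral_cst// -ge0_integralD//; last exact: mV.
  rewrite -ge0_integralD//; last 2 first.
  - exact: mV.
  - exact: measurable_funTS.
  apply: ae_ge0_le_integral => //.
  - by move=> o _; rewrite adde_ge0// lee_fin.
  - by apply: emeasurable_funD; [exact: mV|exact: measurable_cst].
  - by move=> o _; rewrite adde_ge0.
  - by apply: emeasurable_funD; [exact: mV|exact: measurable_funTS].
  apply: filterS3 feas feas' step => o Xo X'o st _.
  rewrite -!EFinD lee_fin !VE//.
  apply: (@le_trans _ _ (KL (X o) u + quad (X o) (Y o))).
    by rewrite /quad !addrA lerD2r.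
  by rewrite lerD2l le_max lexx orbT.
(* The randomness is averaged out first, with the current point fixed. The drift is written as the
   integral of an indicator so that the moment bound can be compared with it at each point. *)
have mean : (\int[P]_(o in A) F (X o, Y o) + (rho * eta)%:E * P (A `&` E) <=
    (N + e)%:E * P A)%E.
  have -> : (\int[P]_(o in A) F (X o, Y o) = \int[P]_(o in A) I o)%E.
    exact: (ge0_integral_conditional mQ mA mX mY conditional_law F_ge0 mF).
  have -> : ((rho * eta)%:E * P (A `&` E) =
      \int[P]_(o in A) ((rho * eta)%:E * (\1_E o)%:E))%E.
    rewrite ge0_integralZl//; last 2 first.
    - by apply/measurable_EFinP; exact: measurable_funTS.
    - by rewrite lee_fin mulr_ge0.
    by rewrite integral_indic// setIC.
  rewrite -ge0_integralD//; last 3 first.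
  - exact: measurable_funTS.
  - by move=> o _; rewrite mule_ge0 ?lee_fin ?mulr_ge0.
  - by apply: measurable_funeM; apply/measurable_EFinP; exact: measurable_funTS.
  rewrite -integral_cst//.
  apply: ae_ge0_le_integral => //.
  - by move=> o _; rewrite adde_ge0 ?mule_ge0 ?lee_fin ?mulr_ge0.
  - apply: emeasurable_funD; first exact: measurable_funTS.
    by apply: measurable_funeM; apply/measurable_EFinP; exact: measurable_funTS.
  - by move=> o _; rewrite lee_fin addr_ge0.
  apply: filterS3 feas valid err => o Xo vo eo _.
  have Uo : U (X o) by case: Xo.
  have hX := U_simplex Uo; have hu := U_simplex Uu.
  have IE : I o = (\int[Q (X o)]_w (quad (X o) w)%:E)%E.
    by apply: eq_integral => w _; rewrite /F/= max_r// quad_ge0.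
  have := psihat_descent_bound mZhat mdelta mzeta delta_simplex
    bounds Xo hX hu c01 reps0 rho0 vo.
  rewrite -[X in (X <= _)%E -> _]/(\int[Q (X o)]_w (quad (X o) w)%:E)%E -IE => Ile.
  apply: (le_trans (leeD2r _ Ile)).
  rewrite -EFinM -EFinD lee_fin.
  have oppE (v : vec) k : (- v) 0 k = - v 0 k by rewrite mxE.
  have -> : dot (grad Z (X o)) (u - X o) = - dot (grad Z (X o)) (X o - u).
    rewrite -[u - X o]opprB /dot -sumrN; apply: eq_bigr => k _.
    by rewrite oppE mulrN.
  have rate : eta * \1_E o <= dot (grad Z (X o)) (X o - u).
    rewrite indicE; have [oE|_] := boolP (o \in E); last by rewrite mulr0 rate0.
    rewrite mulr1; apply: rate_eta => //.
    by move: oE; rewrite inE /E/= VE.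
  have := ler_wpM2l rho0 rate; rewrite mulrA; move: eo; rewrite -/N; lra.
(* The term N P(A) is finite, so it can be added to both sides of the goal and [path] and [mean]
   chained. *)
have PAfin : P A \is a fin_num by exact: fin_num_measure.
have NPA : (N%:E * P A)%E \is a fin_num by rewrite fin_numM.
rewrite -(@leeD2lE _ (N%:E * P A)%E)//.
rewrite addeA [X in (X + _ <= _)%E]addeC.
apply: (le_trans (leeD2r _ path)).
rewrite -addeA; apply: (le_trans (leeD2l _ mean)).
by rewrite EFinD ge0_muleDl ?lee_fin// addeCA.
Qed.

End OneStep.

Section Past.
Context {R : realType} {m : nat} {n : 'I_m -> nat}.
Context {dO dW : measure_display} {Omega : measurableType dO}
        {W : measurableType dW}.
Local Notation vec := 'rV[R]_(\sum_(i < m) n i).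
Local Notation bvec := (borelV R (\sum_(i < m) n i)).
Variables (p : nat -> Omega -> vec) (w : nat -> Omega -> W).

Lemma past_setT k : past p w k setT.
Proof. exact: (@measurableT _ (g_sigma_algebraType _)). Qed.

Lemma past_setI k : setI_closed (past p w k).
Proof. by move=> A B; exact: (@measurableI _ (g_sigma_algebraType _)). Qed.

Lemma past_nondecreasing k : past p w k `<=` past p w k.+1.
Proof.
apply: sub_sigma_algebra2 => A [[l [/andP[l0 lk] h]]|[l [/andP[l0 lk] h]]].
  by left; exists l; rewrite l0 (leq_trans lk).
by right; exists l; rewrite l0 (leq_trans lk).
Qed.

Lemma past_preimage k (B : set bvec) : (0 < k)%N -> measurable B ->
  past p w k (p k @^-1` B).
Proof.
move=> k0 mB; apply: sub_sigma_algebra; left; exists k; rewrite k0 leqnn; split=> //.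
by exists B.
Qed.

Lemma past_measurable k A :
  (forall k, (0 < k)%N -> measurable_fun [set: Omega] (p k : Omega -> bvec)) ->
  (forall k, (0 < k)%N -> measurable_fun [set: Omega] (w k)) ->
  past p w k A -> measurable A.
Proof.
move=> mp mw; apply: (@smallest_sub _ _ _ (@measurable _ Omega)) A.
  exact: sigma_algebra_measurable.
move=> A [[l [/andP[l0 _] [B mB ->]]]|[l [/andP[l0 _] [B mB ->]]]];
  rewrite -[X in measurable X]setTI; [exact: mp|exact: mw].
Qed.

End Past.

Lemma cvg_of_entropy {R : realType} {m : nat} {n : 'I_m -> nat}
    (x : nat -> 'rV[R]_(\sum_(i < m) n i)) (u : 'rV[R]_(\sum_(i < m) n i)) :
  (forall k, prod_simplex (x k.+1)) -> (forall k j, 0 < x k.+1 0 j) ->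
  prod_simplex u ->
  (fun k => entropy_to u (x k.+1)) @ \oo --> (0 : R) -> x @ \oo --> u.
Proof.
move=> hx x0 hu /cvgrPdist_lt cvg0.
apply/cvg_ballP => e e0.
(* The 4 is that of [KL_ge_sq]. Bounding each entry separately is enough, as balls are those of the
   sup norm. *)
have e20 : 0 < e ^+ 2 / 4 by rewrite divr_gt0// exprn_gt0.
have [K _ hK] := cvg0 _ e20.
(* The entropy sequence is shifted by one, because iterates are numbered from 1. *)
exists K.+1 => // -[//|k] /= Kk.
have := hK k Kk; rewrite sub0r normrN => /(le_lt_trans (ler_norm _)).
move=> /(le_lt_trans _) V_lt; split => // i j; rewrite ord1 /ball/=.
have KL_lt : KL (x k.+1) u < e ^+ 2 / 4 by apply: V_lt; rewrite le_max lexx orbT.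
have h : \sum_j (u 0 j - x k.+1 0 j) ^+ 2 / 4 <= KL (x k.+1) u.
  apply: KL_ge_sq => [l|l|]; first by rewrite x0 prod_simplex_le1.
    by rewrite prod_simplex_ge0 ?prod_simplex_le1.
  by rewrite !prod_simplex_sum.
have term : (u 0 j - x k.+1 0 j) ^+ 2 / 4 < e ^+ 2 / 4.
  apply: le_lt_trans KL_lt; apply: le_trans h.
  by rewrite (bigD1 j)//= lerDl sumr_ge0// => l _; rewrite divr_ge0 ?sqr_ge0.
have e0' : 0 <= e by exact: ltW.
rewrite -ltr_sqr ?nnegrE// real_normK ?num_real//.
by move: term; rewrite ltr_pM2r// invr_gt0.
Qed.

Theorem theorem10
  (R : realType) (m : nat) (n : 'I_m -> nat)
  (* feasible region *)
  (U_ : forall i : 'I_m, set 'rV[R]_(n i))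
  (U_simplex : forall i, U_ i `<=` simplex (n i))
  (U_nonempty : forall i, U_ i !=set0)
  (U_compact : forall i, compact (U_ i))
  (U_convex : forall i, convex_set (U_ i))
  (* objective, (A1), (A5) *)
  (Z : 'rV[R]_(\sum_(i < m) n i) -> R)
  (L0 L1 L2 : R) (A1 : smooth_lipschitz Z L0 L1 L2)
  (pstar : 'rV[R]_(\sum_(i < m) n i))
  (A5 : unique_strict_optimum Z (block_prod U_) pstar)
  (* noisy evaluations, (A2) *)
  (dX : measure_display) (Xi : measurableType dX) (nu : probability Xi R)
  (Zhat : 'rV[R]_(\sum_(i < m) n i) -> Xi -> R)
  (sigma : R) (sigma_gt0 : 0 < sigma ^+ 2)
  (A2 : unbiased_evaluations nu Zhat Z sigma)
  (* gradient estimators *)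
  (est : estimator)
  (dW : measure_display) (W : measurableType dW)
  (Q : 'rV[R]_(\sum_(i < m) n i) -> probability W R)
  (delta : nat -> W -> 'rV[R]_(\sum_(i < m) n i)) (zeta : nat -> W -> Xi)
  (sampling : sampling_model nu Q delta zeta (positive_part (block_prod U_)))
  (gamma0 : R) (gamma0_gt0 : 0 < gamma0)
  (B1 B2 c0 : R) (c0_gt0 : 0 < c0)
  (bounds : bias_variance_bounds Zhat Q delta zeta est Z
              (positive_part (block_prod U_)) gamma0 B1 B2 c0)
  (* parameters of the iteration *)
  (a alpha b theta R0 beta Abar d : R)
  (a_gt0 : 0 < a) (alpha_range : 1 / 2 < alpha <= 1)
  (b_gt0 : 0 < b) (alpha_theta : 1 < alpha + theta)
  (R0_gt0 : 0 < R0)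
  (exponents : 1 < 2 * alpha + beta - 2 * d - 2 * theta)
  (Abar_gt0 : 0 < Abar) (d_gt0 : 0 < d)
  (* MDSA iterates *)
  (dO : measure_display) (Omega : measurableType dO) (P : probability Omega R)
  (p : nat -> Omega -> 'rV[R]_(\sum_(i < m) n i)) (w : nat -> Omega -> W)
  (p_measurable : forall k, (0 < k)%N ->
     measurable_fun [set: Omega]
       (p k : Omega -> borelV R (\sum_(i < m) n i)))
  (w_measurable : forall k, (0 < k)%N -> measurable_fun [set: Omega] (w k))
  (randomness : fresh_randomness P Q p w)
  (start : forall o, block_prod U_ (p 1%N o))
  (points : {ae P, forall o, forall k j : nat, (0 < k)%N ->
     (j < replications R0 beta k)%N ->
     valid_points est (power_decay b theta k) (p k o) (delta j (w k o))})
  (steps : {ae P, forall o, forall k : nat, (0 < k)%N ->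
     mirror_step (block_prod U_) (power_decay a alpha k)
       (psihat Zhat delta zeta est (p k o) (power_decay b theta k)
          (replications R0 beta k) (multiplier gamma0 (p k o)) (w k o))
       (p k o) (p k.+1 o)})
  (A6 : {ae P, forall o, forall k : nat, (0 < k)%N ->
     power_decay Abar d k <= min_entry (p k o)}) :
  {ae P, forall o, p ^~ o @ \oo --> pstar}.
Proof.
have [[Upstar _] _ strict] := A5.
have [mZhat _] := A2.
have [mQ mdelta mzeta delta_simplex _] := sampling.
set U := block_prod U_ in Upstar strict sampling bounds start steps *.
have Usub : U `<=` prod_simplex by move=> q; exact: block_prod_simplex.
have hu := Usub _ Upstar.
have u01 j : 0 <= pstar 0 j <= 1 by rewrite prod_simplex_ge0 ?prod_simplex_le1.
have [[_ _ _ cgrad _] _] := A1.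
(* Membership in [U] comes from [start] for the first iterate and from the argmin afterwards;
   positivity comes from (A6). *)
have feas : {ae P, forall o, forall k, positive_part U (p k.+1 o)}.
  apply: filterS2 steps A6 => o st A6o k; split.
    by case: k => [|k]; [exact: start|exact: (st k.+1 isT).1].
  move=> j; apply: lt_le_trans (min_entry_le (p k.+1 o) j).
  by apply: lt_le_trans (A6o k.+1 isT); rewrite divr_gt0// powR_gt0.
have feas_k k : {ae P, forall o, positive_part U (p k.+1 o)}.
  by apply: filterS feas => o; exact.
have mirror k : {ae P, forall o,
    KL (p k.+2 o) pstar <= KL (p k.+1 o) pstar + power_decay a alpha k.+1 *
      dot (psihat Zhat delta zeta est (p k.+1 o) (power_decay b theta k.+1)
          (replications R0 beta k.+1) (multiplier gamma0 (p k.+1 o)) (w k.+1 o))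
        (pstar - p k.+1 o)
    + power_decay a alpha k.+1 ^+ 2 * \sum_j
       (psihat Zhat delta zeta est (p k.+1 o) (power_decay b theta k.+1)
          (replications R0 beta k.+1) (multiplier gamma0 (p k.+1 o)) (w k.+1 o)) 0 j ^+ 2}.
  apply: filterS3 (feas_k k) (feas_k k.+1) steps => o [Ux x0] [Ux' x'0] /(_ k.+1 isT) [_ opt].
  have hx := Usub _ Ux; have hx' := Usub _ Ux'.
  apply: mirror_descent_inequality.
  - by move=> j; rewrite x0 prod_simplex_le1.
  - by move=> j; rewrite x'0 prod_simplex_le1.
  - by move=> j; exact: prod_simplex_ge0.
  - by rewrite !prod_simplex_sum.
  - by rewrite !prod_simplex_sum.
  move=> t t01; have := opt _ (block_prod_segment U_convex Ux' Upstar t01).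
  by rewrite !blockKL_KL.
have law k A (B1' : set (borelV R (\sum_(i < m) n i))) (B2' : set W) :
    past p w k.+1 A -> measurable B1' -> measurable B2' ->
    P ((A `&` p k.+1 @^-1` B1') `&` w k.+1 @^-1` B2') =
    (\int[P]_(o in A `&` p k.+1 @^-1` B1') Q (p k.+1 o) B2')%E.
  move=> FA mB1' mB2'; apply: randomness => //.
  by apply: past_setI => //; exact: past_preimage.
(* Direction 0 is always sampled, as there is at least one replication. Its feasibility passes to
   the law Q p_k, and from there to all directions. *)
have valid k : {ae P, forall o, {ae Q (p k.+1 o), forall x, forall j,
    valid_points est (power_decay b theta k.+1) (p k.+1 o) (delta j x)}}.
  have v0 : {ae P, forall o, {ae Q (p k.+1 o), forall x,
      valid_points est (power_decay b theta k.+1) (p k.+1 o) (delta 0%N x)}}.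
    apply: (@ae_conditional _ _ _ _ (borelV R (\sum_(i < m) n i)) W R P Q mQ (p k.+1) (w k.+1)
      [set x | valid_points est (power_decay b theta k.+1) x.1 (delta 0%N x.2)]) => //.
    - exact: p_measurable.
    - exact: w_measurable.
    - move=> B1' B2' mB1' mB2'.
      have FT : past p w k.+1 setT by exact: past_setT.
      by have := law k setT B1' B2' FT mB1' mB2'; rewrite !setTI.
    - have m1 : measurable_fun [set: (borelV R (\sum_(i < m) n i) * W)%type]
          (fst : _ -> borelV R (\sum_(i < m) n i)) := measurable_fst.
      have m2 : measurable_fun [set: (borelV R (\sum_(i < m) n i) * W)%type]
          (delta 0%N \o snd : _ -> borelV R (\sum_(i < m) n i)).
        exact: (measurableT_comp (mdelta 0%N) measurable_snd).
      exact: (measurable_valid_points m1 m2 est (power_decay b theta k.+1)).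
    - by apply: filterS points => o /(_ k.+1 0%N isT isT).
  apply: filterS2 (feas_k k) v0 => o Xo.
  exact: valid_points_all sampling Xo.
have theta0 : 0 < theta by case/andP: alpha_range => _ ?; lra.
(* From [K] on, c_k < c0 and the bias and variance bounds apply; earlier iterations do not affect
   convergence. *)
have [K cK] := power_decay_lt b_gt0 theta0 c0_gt0.
have [G gradG] := grad_bounded A1 hu.
pose N : R := (\sum_(i < m) n i)%:R.
(* [C1] comes from the bias in the linear term, [C2] from the squared mean of the estimate, with c_k
   bounded by c0, and [C3] from the variance. Absolute values stand where no sign is known. *)
pose C1 := N * `|B1| * (a * b).
pose C2 := a ^+ 2 * (2 * (B1 * c0) ^+ 2 + 2 * `|G|).
pose C3 := a ^+ 2 * `|B2| * gamma0 / (Abar ^+ 2 * R0 * b ^+ 2).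
pose s3 := 2 * alpha + beta - 2 * d - 2 * theta.
pose e (k : nat) : R := C1 * (k.+1%:R `^ (alpha + theta))^-1 +
  C2 * (k.+1%:R `^ (2 * alpha))^-1 + C3 * (k.+1%:R `^ s3)^-1.
have N0 : 0 <= N by exact: ler0n.
have C10 : 0 <= C1 by rewrite !mulr_ge0// ltW.
have C20 : 0 <= C2 by rewrite mulr_ge0 ?sqr_ge0// addr_ge0// mulr_ge0// sqr_ge0.
have C30 : 0 <= C3.
  by rewrite divr_ge0 ?mulr_ge0 ?sqr_ge0// ltW.
have e0 k : 0 <= e k.
  by rewrite !addr_ge0// mulr_ge0// invr_ge0 powR_ge0.
have e_cvg : cvgn (series e).
  have alpha2 : 1 < 2 * alpha by case/andP: alpha_range => ? _; lra.
  have h1 := is_cvg_seriesZ (k := C1) (cvg_power_series alpha_theta).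
  have h2 := is_cvg_seriesZ (k := C2) (cvg_power_series alpha2).
  have h3 := is_cvg_seriesZ (k := C3) (cvg_power_series (exponents : 1 < s3)).
  exact: (is_cvg_seriesD (is_cvg_seriesD h1 h2) h3).
have rho_dvg : ~ cvgn (series (fun k => power_decay a alpha k.+1)).
  move=> h; have alpha01 : 0 <= alpha <= 1.
    by case/andP: alpha_range => ? ->; rewrite andbT; lra.
  apply: (dvg_riemannR alpha01).
  have <- : a^-1 *: (fun k => power_decay a alpha k.+1) = riemannR alpha.
    apply/funext => k; rewrite /power_decay /riemannR.
    by rewrite -[LHS]/(a^-1 * (a / (k.+1%:R `^ alpha))) mulKf// gt_eqF.
  exact: is_cvg_seriesZ.
have rho0 k : 0 <= power_decay a alpha k.+1.
  by rewrite divr_ge0 ?powR_ge0// ltW.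
have err k : (K <= k)%N -> {ae P, forall o,
    power_decay a alpha k.+1 * (N * (`|B1| * power_decay b theta k.+1))
     + power_decay a alpha k.+1 ^+ 2 * (2 * (B1 * power_decay b theta k.+1) ^+ 2 +
       2 * (\sum_j grad Z (p k.+1 o) 0 j ^+ 2)
       + B2 * (multiplier gamma0 (p k.+1 o) /
          ((replications R0 beta k.+1)%:R * power_decay b theta k.+1 ^+ 2))) <= e k}.
  move=> Kk; apply: filterS2 (feas_k k) A6 => o [Ux _] /(_ k.+1 isT) A6o.
  rewrite mulrDr addrA /e; apply: lerD; last first.
    exact: variance_decay.
  apply: lerD.
    rewrite le_eqVlt; apply/orP; left; apply/eqP.
    rewrite /C1 -[RHS]mulrA -power_decayM; ring.
  rewrite power_decay_sqr /C2 -mulrA -[leRHS]mulrA; apply: ler_wpM2l; first exact: sqr_ge0.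
  rewrite [leRHS]mulrC; apply: ler_wpM2l; first by rewrite invr_ge0 powR_ge0.
  apply: lerD; apply: ler_wpM2l => //.
    rewrite [leLHS]exprMn [leRHS]exprMn; apply: ler_wpM2l; first exact: sqr_ge0.
    have pd0 : 0 <= power_decay b theta k.+1 by rewrite divr_ge0 ?powR_ge0// ltW.
    by rewrite ler_sqr ?nnegrE ?(ltW c0_gt0)//; exact/ltW/cK.
  exact: le_trans (gradG _ (Usub _ Ux)) (ler_norm _).
have mpast k A : past p w k A -> measurable A by exact: past_measurable.
have V_past k (S : set R) : measurable S ->
    past p w k.+1 ((fun o => entropy_to pstar (p k.+1 o)) @^-1` S).
  move=> mS; have := measurable_entropy_to pstar measurableT mS; rewrite setTI.
  exact: past_preimage.
have V_cvg : {ae P, forall o, (fun k => entropy_to pstar (p k.+1 o)) @ \oo --> (0 : R)}.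
  apply: (@descent_cvg _ _ _ P (fun k => past p w k.+1)
    (fun k o => entropy_to pstar (p k.+1 o)) (fun k => power_decay a alpha k.+1) e K) => //.
  - by move=> k A; exact: mpast.
  - by move=> k; exact: past_nondecreasing.
  - by move=> k; exact: past_setI.
  - by move=> k; exact: past_setT.
  - move=> k r; have := V_past k _ (measurable_itv `]-oo, r[).
    by congr (past _ _ _); apply/seteqP; split => o /=; rewrite in_itv/=.
  - move=> k r; have := V_past k _ (measurable_itv `[r, +oo[).
    by congr (past _ _ _); apply/seteqP; split => o /=; rewrite in_itv/= andbT.
  - by move=> k o; rewrite le_max lexx.
  - move=> k _.
    (* A deterministic bound on V at iteration k + 1. It grows with k, but only integrability at
       each fixed k is at stake. *)
    pose M := (\sum_j pstar 0 j) * ln (power_decay Abar d k.+1)^-1.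
    apply: (@le_lt_trans _ _ (\int[P]_(o in setT) (`|M|)%:E)%E); last first.
      by rewrite integral_cst// [X in (_ * X)%E](probability_setT P) mule1 ltry.
    apply: ae_ge0_le_integral => //.
    + by move=> o _; rewrite lee_fin le_max lexx.
    + apply/measurable_EFinP.
      exact: (measurableT_comp (measurable_entropy_to pstar) (p_measurable k.+1 isT)).
    apply: filterS A6 => o /(_ k.+1 isT) A6o _; rewrite lee_fin ge_max normr_ge0 /=.
    apply: le_trans (ler_norm _); apply: KL_le_lnV => //.
      by rewrite divr_gt0 ?powR_gt0//= (le_trans A6o)// min_entry_le1.
    by move=> j; exact: le_trans A6o (min_entry_le _ _).
  - move=> eps eps0.
    have u0 j : 0 <= pstar 0 j by case/andP: (u01 j).
    have [eta eta0 away] := descent_rate_away U_simplex U_compact cgrad u0 strict eps0.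
    exists eta => // k A Kk FA.
    apply: (@one_step_descent _ _ _ _ _ _ _ _ _ nu Zhat P Q delta zeta mZhat
      (p k.+1) (p k.+2) (w k.+1) A (p_measurable k.+1 isT) (p_measurable k.+2 isT)
      (w_measurable k.+1 isT) (mpast _ _ FA)
      (fun B1' B2' => law k A B1' B2' FA) U pstar sampling Usub Upstar est Z
      gamma0 B1 B2 c0 (power_decay b theta k.+1) (power_decay a alpha k.+1)
      (replications R0 beta k.+1) bounds _ isT (rho0 k) (e k) eps eta) => //.
    + by rewrite cK// andbT divr_gt0// powR_gt0.
    + exact: ltW.
    + exact: err.
    + move=> q Uq; have [->|qu] := eqVneq q pstar; last exact/ltW/strict.
      by rewrite subrr /dot big1// => j _; rewrite [X in _ * X]mxE mulr0.
apply: filterS2 feas V_cvg => o fo Vo.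
apply: cvg_of_entropy hu Vo => [k|k j]; first exact: Usub (fo k).1.
exact: (fo k).2.
Qed.
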